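(* Let $\mu>0$ and let $k$ be the (Cauchy) density with characteristic function $\phi_k(t)=e^{-|t|/\mu}$. Let $X_j=Y_j+Z_j$, $j=1,2,\dots$, be i.i.d. real random variables, where for each $j$ the variables $Y_j$ and $Z_j$ are independent, $Y_j$ has a probability density $f$ on $\mathbb{R}$ and $Z_j$ has density $k$; let $g=k*f$ be the density of $X_j$. Let $f_{nh}$ be the kernel type deconvolution density estimator based on $X_1,\dots,X_n$ with the sinc kernel $w(x)=\sin x/(\pi x)$ and bandwidth $h=h_n>0$, and let $x\in\mathbb{R}$. Then, as $n\to\infty$ and $h\to 0$, $$ \sqrt{n}\,e^{-\frac{1}{\mu h}}\,\bigl(f_{nh}(x)-\mathrm{E}\, f_{nh}(x)\bigr)\ \xrightarrow{\ \mathcal{D}\ }\ N(0,\sigma^2), $$ with $$ \sigma^2=\frac{1}{2\pi^2}\int_{-\infty}^{\infty}\frac{\mu^2}{1+\mu^2(u-x)^2}\,g(u)\,du. $$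
   Context: The bandwidth $h=h_n$ is a deterministic sequence of positive numbers. The kernel type deconvolution estimator of $f(x)$ with kernel $w$ and bandwidth $h$ is $$ f_{nh}(x)=\frac{1}{2\pi}\int_{-\infty}^{\infty} e^{-itx}\,\frac{\phi_w(ht)\,\phi_{emp}(t)}{\phi_k(t)}\,dt,\qquad \phi_{emp}(t)=\frac1n\sum_{j=1}^n e^{itX_j}, $$ where $\phi_w$ and $\phi_k$ are the characteristic functions (Fourier transforms $\int e^{itx}(\cdot)\,dx$) of $w$ and $k$. For the sinc kernel $w(x)=\sin x/(\pi x)$ one takes $\phi_w(t)=I_{[-1,1]}(t)$. $*$ denotes convolution, $\xrightarrow{\mathcal{D}}$ denotes convergence in distribution and $N(0,\sigma^2)$ the normal distribution with mean $0$ and variance $\sigma^2$. *)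

(* Defs.v *)
From HB Require Import structures.
From mathcomp Require Import all_boot all_order all_algebra finmap complex.
From mathcomp Require Import all_classical all_reals all_analysis.
From mathcomp Require Import measurable_realfun.

Set Implicit Arguments.
Unset Strict Implicit.
Unset Printing Implicit Defensive.

Import Order.TTheory GRing.Theory Num.Theory.
Import numFieldNormedType.Exports.

Local Open Scope classical_set_scope.
Local Open Scope complex_scope.
Local Open Scope ring_scope.

(* e^{i t} for real t *)
Definition expi (R : realType) (t : R) : R[i] := cos t +i* sin t.

(* Lebesgue integral over the real line of a complex-valued function *)
Definition cintegral (R : realType) (F : R -> R[i]) : R[i] :=
  (\int[lebesgue_measure]_t complex.Re (F t)) +i*
  (\int[lebesgue_measure]_t complex.Im (F t)).

Definition fourier (R : realType) (k : R -> R) (t : R) : R[i] :=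
  cintegral (fun x => expi (t * x) * (k x)%:C).

Definition convolution (R : realType) (k f : R -> R) (u : R) : R :=
  \int[lebesgue_measure]_y (k (u - y) * f y).

Definition is_pdf (R : realType) (f : R -> R) : Prop :=
  [/\ measurable_fun setT f, (forall u, 0 <= f u) &
      (\int[lebesgue_measure]_u (f u)%:E = 1)%E].

Section random_variables.
Context (d : measure_display) (T : measurableType d) (R : realType).
Variable P : probability T R.

Definition has_density (X : {RV P >-> R}) (f : R -> R) : Prop :=
  is_pdf f /\
  forall A : set R, measurable A ->
    distribution P X A = (\int[lebesgue_measure]_(u in A) (f u)%:E)%E.

Definition independent2 (X Y : {RV P >-> R}) : Prop :=
  forall A B : set R, measurable A -> measurable B ->
    P (X @^-1` A `&` Y @^-1` B) = (P (X @^-1` A) * P (Y @^-1` B))%E.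

Definition mutually_independent (X : nat -> {RV P >-> R}) : Prop :=
  forall (J : {fset nat}) (A : nat -> set R), (forall j, measurable (A j)) ->
    P (\bigcap_(j in [set` J]) (X j @^-1` A j)) =
    (\prod_(j <- J) P (X j @^-1` A j))%E.

Definition identically_distributed (X : nat -> {RV P >-> R}) : Prop :=
  forall (i j : nat) (A : set R), measurable A ->
    distribution P (X i) A = distribution P (X j) A.

Definition iid (X : nat -> {RV P >-> R}) : Prop :=
  mutually_independent X /\ identically_distributed X.

Definition cvg_in_distribution (W : nat -> T -> R)
    (Q : probability (measurableTypeR R) R) : Prop :=
  (forall n, measurable_fun setT (W n)) /\
  forall a : R, {for a, continuous (fun b : R => Q `]-oo, b]%classic)} ->
    P (W n @^-1` `]-oo, a]) @[n --> \oo] --> Q `]-oo, a]%classic.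

End random_variables.

Section deconvolution.
Context (R : realType).

Definition phi_emp (T : Type) (X : nat -> T -> R) (n : nat) (w : T) (t : R) :
    R[i] :=
  n%:R^-1 * \sum_(j < n) expi (t * X j w).

Definition decon_estC (T : Type) (phi_w phi_k : R -> R[i]) (X : nat -> T -> R)
    (n : nat) (h x : R) (w : T) : R[i] :=
  ((2 * pi)^-1)%:C *
  cintegral (fun t =>
    expi (- (t * x)) * (phi_w (h * t) * phi_emp X n w t / phi_k t)).

(* The Fourier transform of the sinc kernel, which is not integrable, is taken
   to be the indicator of [-1, 1]. *)
Definition phi_sinc (t : R) : R[i] := (\1_(`[-1, 1]) t)%:C.

(* Taking the real part loses nothing for the sinc kernel and a phi_k of the form
   expR (- `|t| / mu): see decon_estC_real below. *)
Definition decon_est (T : Type) (phi_w phi_k : R -> R[i]) (X : nat -> T -> R)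
    (n : nat) (h x : R) (w : T) : R :=
  complex.Re (decon_estC phi_w phi_k X n h x w).

Lemma Rintegral_odd (G : R -> R) : measurable_fun setT G ->
  (forall t, G (- t) = - G t) -> \int[lebesgue_measure]_t G t = 0.
Proof.
move=> mG oddG; rewrite /Rintegral integralE.
have -> : (\int[lebesgue_measure]_t ((EFin \o G)^\- t) =
    \int[lebesgue_measure]_t ((EFin \o G)^\+ t))%E.
  transitivity (\int[pushforward lebesgue_measure
      (-%R : R -> measurableTypeR R)]_t ((EFin \o G)^\+ t))%E.
    rewrite ge0_integral_pushforward//=.
      rewrite preimage_setT; apply: eq_integral => t _ /=.
      by rewrite funeposE funenegE /= oddG.
    exact/measurable_funepos/measurable_EFinP.
  by apply: eq_measure_integral => //= A mA _; exact: lebesgue_measureN.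
by case: integral => //= r; rewrite subrr.
Qed.

Lemma decon_estC_real (T : Type) (phi_k : R -> R[i]) (mu : R)
    (X : nat -> T -> R) (n : nat) (h x : R) (w : T) :
  (forall t, phi_k t = (expR (- `|t| / mu))%:C) ->
  decon_estC phi_sinc phi_k X n h x w =
  (decon_est phi_sinc phi_k X n h x w)%:C.
Proof.
move=> phi_kE; rewrite /decon_est /decon_estC.
set F := fun t => _.
suff Im0 : \int[lebesgue_measure]_t complex.Im (F t) = 0.
  by rewrite /cintegral Im0; simpc.
pose c t : R := \1_(`[-1, 1]) (h * t) / n%:R * expR (`|t| / mu).
have FE t : complex.Im (F t) = c t * \sum_(j < n) sin (t * (X j w - x)).
  have cE : F t = (c t)%:C * \sum_(j < n) expi (t * (X j w - x)).
    have eD (a b : R) : expi (a + b) = expi a * expi b.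
      by rewrite /expi cosD sinD; simpc; congr (_ +i* _); rewrite addrC mulrC.
    rewrite /F /phi_emp phi_kE /phi_sinc mulNr expRN fmorphV/= invrK.
    have -> : \sum_(j < n) expi (t * (X j w - x)) =
        expi (- (t * x)) * \sum_(j < n) expi (t * X j w).
      by rewrite mulr_sumr; apply: eq_bigr => j _; rewrite mulrBr addrC eD.
    rewrite /c !rmorphM/= fmorphV/= !rmorph_nat.
    by rewrite [RHS]mulrCA -!mulrA (mulrC (\sum_(j < n) _)).
  rewrite cE; move: (c t) => r.
  have ImD : {morph (@complex.Im R) : a b / a + b} by case=> ? ? [].
  have ReIm0 (z : R[i]) : complex.Im (r%:C * z) = r * complex.Im z.
    by case: z => a b /=; rewrite mul0r addr0.
  by rewrite ReIm0 (big_morph _ ImD (erefl : complex.Im 0 = 0)).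
apply: Rintegral_odd => [|t].
  have mM (a : R) : measurable_fun [set: R] ( *%R a) by exact: measurable_funM.
  under eq_fun do rewrite FE.
  apply: measurable_funM; last first.
    apply: measurable_sum => j; apply: measurableT_comp => /=.
      apply: continuous_measurable_fun => y; exact: continuous_sin.
    by under eq_fun do rewrite mulrC; exact: mM.
  apply: measurable_funM.
    apply: measurable_funM => //.
    by apply: measurableT_comp (mM h); exact: measurable_indic.
  apply: measurableT_comp => //; apply: measurable_funM => //.
rewrite !FE /c normrN mulrN -[RHS]mulrN -sumrN; congr (_ / _ * _ * _).
  by rewrite !indicE !mem_setE !in_itv/= lerNl opprK andbC lerNl.
by apply: eq_bigr => j _; rewrite mulNr sinN.
Qed.

End deconvolution.

(* Main.v *)
(* With a = 1/mu, M = 1/h and b = X_j - x, integrating the sinc-truncated inverse transform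
   gives f_nh(x) = n^-1 e^(aM) sum_j xi(X_j - x) / pi, where
     xi(b) = e^(-aM) Re int_0^M e^((a+ib)t) dt
           = (a cos bM + b sin bM - a e^(-aM)) / (a^2 + b^2)
   is bounded uniformly in M. The claim is thus a central limit theorem for a uniformly
   bounded triangular array of row-wise i.i.d. variables.

   That limit theorem is proved by Lindeberg's telescoping sum along the heat flow: if Phi is
   the standard normal distribution function, u(s, y) = Phi((c - y) / sqrt s) solves the heat
   equation, so replacing one summand of variance v by an increase of s by v changes the
   expectation of u only to third order in the size of the summand.

   For the moments, independence and the Cauchy characteristic function give
   |E cos(t(X_j - x))| <= e^(-a|t|), and Fubini turns this into
   |E int_0^L p(t) e^(at) cos(bt) dt| <= L sup |p|. The weight p = 1 shows E xi -> 0; the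
   weight p = L - t with L = 2M controls the oscillating part of
   xi^2 = 1/(2(a^2+b^2)) + Re[e^(2ibM) / (a+ib)^2] / 2 + O(e^(-aM)). *)
Require Import Defs.
From HB Require Import structures.
From mathcomp Require Import all_boot all_order all_algebra finmap complex.
From mathcomp Require Import all_classical all_reals all_analysis.
From mathcomp Require Import measurable_realfun.
From mathcomp Require Import ring lra.

Import Order.TTheory GRing.Theory Num.Theory.
Import numFieldNormedType.Exports.

Set Implicit Arguments.
Unset Strict Implicit.
Unset Printing Implicit Defensive.

Local Open Scope classical_set_scope.
Local Open Scope complex_scope.
Local Open Scope ring_scope.

(** * Taylor expansions with explicit remainder bounds *)

Section taylor.
Context {R : realType}.
Implicit Types (F : R -> R) (x y a b : R).

(** The two points are left unordered so that the expansions below serve increments of either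
    sign. *)
Lemma MVT_between F (F' : R -> R) x y :
  (forall t : R, is_derive t (1 : R) F (F' t)) ->
  exists2 c, (x <= c <= y) || (y <= c <= x) & F y - F x = F' c * (y - x).
Proof.
move=> dF; have cF a b : {within `[a, b], continuous F}.
  apply: continuous_subspaceT => t; apply: differentiable_continuous.
  exact/derivable1_diffP.
have [xy|/ltW yx] := leP x y.
  have [c] := MVT_segment xy (fun t _ => dF t) (cF x y).
  by rewrite in_itv/= => cxy ?; exists c; rewrite ?cxy.
have [c] := MVT_segment yx (fun t _ => dF t) (cF y x).
rewrite in_itv/= => cxy E; exists c; rewrite ?cxy ?orbT//.
by rewrite -opprB E; lra.
Qed.

(** The mean value theorem is applied to [F] and then to [F1], losing only the factor 1/2 of the
    sharp constant. The bound on [F2] is local because the one used in [ncdf_scale_taylor] is proved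
    only between the two points. *)
Lemma taylor1_bound F (F1 F2 : R -> R) x y (K : R) :
  (forall t : R, is_derive t (1 : R) F (F1 t)) ->
  (forall t : R, is_derive t (1 : R) F1 (F2 t)) ->
  (forall t, (x <= t <= y) || (y <= t <= x) -> `|F2 t| <= K) ->
  `|F y - F x - F1 x * (y - x)| <= K * (y - x) ^+ 2.
Proof.
move=> dF dF1 K2; have [c cxy ->] := MVT_between x y dF.
have [e exc E] := MVT_between x c dF1.
have cx_le : `|c - x| <= `|y - x|.
  by case/orP: cxy => /andP[? ?]; case: (ler0P (c - x)); case: (ler0P (y - x)); lra.
rewrite -mulrBl E !normrM -(real_normK (num_real (y - x))) expr2 mulrA.
apply: ler_wpM2r => //; apply: ler_pM => //.
by apply: K2; case/orP: cxy exc => /andP[? ?] /orP[] /andP[? ?]; apply/orP; lra.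
Qed.

(** The derivative of [F] minus its quadratic Taylor polynomial at [x] is the first order remainder
    of [F1]. One mean value step and [taylor1_bound] for [F1] then give the cubic bound, without the
    sharp factor 1/6. *)
Lemma taylor2_bound F (F1 F2 F3 : R -> R) x y (K : R) :
  (forall t : R, is_derive t (1 : R) F (F1 t)) ->
  (forall t : R, is_derive t (1 : R) F1 (F2 t)) ->
  (forall t : R, is_derive t (1 : R) F2 (F3 t)) ->
  (forall t, `|F3 t| <= K) ->
  `|F y - F x - F1 x * (y - x) - F2 x * (y - x) ^+ 2 / 2| <= K * `|y - x| ^+ 3.
Proof.
move=> dF dF1 dF2 K3.
pose G t := F t - F1 x * (t - x) - F2 x * (t - x) ^+ 2 / 2.
have dG (t : R) : is_derive t (1 : R) G (F1 t - F1 x - F2 x * (t - x)).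
  by rewrite /G; apply: is_derive_eq; rewrite /GRing.scale/=; field.
have [c cxy E] := MVT_between x y dG.
have -> : F y - F x - F1 x * (y - x) - F2 x * (y - x) ^+ 2 / 2 = G y - G x.
  by rewrite /G; ring.
have cx_le : `|c - x| <= `|y - x|.
  by case/orP: cxy => /andP[? ?]; case: (ler0P (c - x)); case: (ler0P (y - x)); lra.
rewrite E normrM exprSr mulrA; apply: ler_wpM2r => //.
apply: (le_trans (taylor1_bound dF1 dF2 (fun t _ => K3 t))).
apply: ler_wpM2l; first exact: le_trans (K3 0).
by rewrite -(real_normK (num_real (c - x))) lerXn2r ?nnegrE.
Qed.

End taylor.

(** * The standard normal distribution function *)

Section standard_normal.
Context {R : realType}.
Implicit Types x y z a s v p : R.
Local Notation mu := (@lebesgue_measure R).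

Definition npdf x : R := normal_pdf 0 1 x.
Definition ncdf x : R := \int[mu]_(t in `]-oo, x]) npdf t.

Lemma npdfE x : npdf x = normal_peak 1 * expR (- (x ^+ 2 / 2)).
Proof.
rewrite /npdf normal_pdfE ?oner_neq0// /normal_fun subr0 expr1n mulNr.
by rewrite mulr2n.
Qed.

Lemma normal_peak1_le1 : normal_peak (1 : R) <= 1.
Proof.
rewrite /normal_peak invf_le1; last first.
  by rewrite sqrtr_gt0 expr1n mul1r mulrn_wgt0// pi_gt0.
rewrite -[leLHS]sqrtr1 ler_wsqrtr// expr1n mul1r mulr2n.
by have := @pi_ge2 R; lra.
Qed.

Lemma npdf_ge0 x : 0 <= npdf x. Proof. exact: normal_pdf_ge0. Qed.

Lemma continuous_npdf : continuous npdf.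
Proof. by apply: continuous_normal_pdf; exact: oner_neq0. Qed.

Lemma integrable_npdf A : measurable A -> mu.-integrable A (EFin \o npdf).
Proof.
by move=> mA; exact: integrableS (integrable_normal_pdf 0 1).
Qed.

Global Instance is_derive_ncdf x : is_derive x 1 ncdf (npdf x).
Proof.
have x1 : x < x + 1 by rewrite ltrDl.
have ix1 := integrable_npdf (measurable_itv `]-oo, x + 1]).
have [] := continuous_FTC1 x1 ix1 (ltNyr _) (@continuous_npdf x).
by move=> d1 d2; split; [exact: d1|rewrite -derive1E; exact: d2].
Qed.

Global Instance is_derive_npdf x : is_derive x 1 npdf (- x * npdf x).
Proof.
pose e y : R := expR (- (y ^+ 2 / 2)).
have -> : npdf = normal_peak 1 \*: e by apply/funext => y; rewrite npdfE.
have de : is_derive x 1 e (- x * e x).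
  by rewrite /e; apply: is_derive_eq; rewrite /GRing.scale/=; field.
by apply: is_derive_eq; rewrite /= /GRing.scale/=; ring.
Qed.

Lemma continuous_ncdf : continuous ncdf.
Proof. by move=> t; apply: differentiable_continuous; exact/derivable1_diffP. Qed.

Lemma measurable_ncdf : measurable_fun setT ncdf.
Proof. by apply: continuous_measurable_fun; exact: continuous_ncdf. Qed.

Lemma normal_pdf0E s t : 0 < s -> normal_pdf 0 s t = npdf (t / s) * s^-1.
Proof.
move=> s0; rewrite npdfE normal_pdfE ?gt_eqF// /normal_fun /normal_peak subr0.
rewrite [RHS]mulrAC; congr (_ * expR _); last by field; rewrite gt_eqF.
rewrite expr1n mul1r -mulrnAr sqrtrM ?sqr_ge0// sqrtr_sqr gtr0_norm//.
by rewrite invfM mulrC.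
Qed.

Lemma ncdf_EFin x : (ncdf x)%:E = normal_prob 0 1 `]-oo, x].
Proof.
rewrite /ncdf /Rintegral fineK//.
exact: (integrable_fin_num _ (integrable_npdf _)).
Qed.

Lemma normal_prob_ncdf s x : 0 < s ->
  normal_prob 0 s `]-oo, x] = (ncdf (x / s))%:E.
Proof.
move=> s0; rewrite ncdf_EFin /normal_prob.
pose F (t : R) : R := t / s.
have dF (t : R) : is_derive t (1 : R) F s^-1.
  by rewrite /F; apply: is_derive_eq; rewrite /GRing.scale/=; field; rewrite gt_eqF.
have F'E : F^`()%classic = cst s^-1.
  by apply/funext => t; rewrite derive1E derive_val.
have sV0 : 0 < s^-1 by rewrite invr_gt0.
rewrite -[x / s]/(F x) (@increasing_ge0_integration_by_substitutionNy _ F npdf x).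
- by apply: eq_integral => t _; rewrite F'E /= normal_pdf0E.
- by move=> u v _ _ uv; rewrite /F ltr_pM2r.
- by rewrite F'E => t _; exact: cvg_cst.
- by rewrite F'E; exact: is_cvg_cst.
- by rewrite F'E; exact: cvg_cst.
- split => //; apply: cvg_at_left_filter.
  by apply: differentiable_continuous; exact/derivable1_diffP.
- by apply/gt0_cvgMlNy.
- exact/continuous_subspaceT/continuous_npdf.
- by move=> t _; exact: npdf_ge0.
Qed.

Lemma ncdf_ge0 x : 0 <= ncdf x.
Proof. by apply: Rintegral_ge0 => t _; exact: npdf_ge0. Qed.

Lemma ncdf_le1 x : ncdf x <= 1.
Proof. by rewrite -lee_fin ncdf_EFin probability_le1. Qed.

(** The identity, as a random variable under the standard normal law, has distribution function
    [ncdf]; the general limits of a [cdf] at infinity thus carry over to [ncdf]. *)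
Let idR : measurableTypeR R -> R := idfun.
Let midR : measurable_fun setT idR. Proof. exact: measurable_id. Qed.
HB.instance Definition _ := isMeasurableFun.Build _ _ _ _ idR midR.
Let idN : {RV (normal_prob 0 1 : probability (measurableTypeR R) R) >-> R} := idR.

Let cdfE : cdf idN = EFin \o ncdf.
Proof. by apply/funext => x; rewrite /= ncdf_EFin. Qed.

Lemma ncdf_cvgNy : ncdf x @[x --> -oo] --> (0 : R).
Proof.
have := cvg_cdfNy0 idN.
by rewrite cdfE => /fine_cvgP[].
Qed.

Lemma ncdf_cvgy : ncdf x @[x --> +oo] --> (1 : R).
Proof.
have := cvg_cdfy1 idN.
by rewrite cdfE => /fine_cvgP[].
Qed.

Lemma ncdf_nondecreasing : {homo ncdf : x y / x <= y}.
Proof.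
move=> x y xy; rewrite -lee_fin !ncdf_EFin le_measure ?inE//.
exact: subset_itvl.
Qed.

Lemma npdf_le_exp x : npdf x <= expR (- (x ^+ 2 / 2)).
Proof. by rewrite npdfE ler_piMl ?expR_ge0 ?normal_peak1_le1. Qed.

(** From [1 + y <= expR y]. Gaussian decay becomes a polynomial inequality, from which the next two
    bounds follow by nonlinear arithmetic. *)
Lemma npdf_le_inv x : npdf x * (1 + x ^+ 2 / 2) <= 1.
Proof.
apply: (@le_trans _ _ (expR (- (x ^+ 2 / 2)) * expR (x ^+ 2 / 2))).
  apply: ler_pM; rewrite ?npdf_ge0 ?npdf_le_exp ?expR_ge1Dx//.
  by rewrite addr_ge0// divr_ge0// sqr_ge0.
by rewrite -expRD addNr expR0.
Qed.

Lemma normrM_npdf_le1 x : `|x * npdf x| <= 1.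
Proof.
rewrite normrM (ger0_norm (npdf_ge0 x)).
have := npdf_le_inv x; have := npdf_ge0 x; have := real_normK (num_real x).
have := normr_ge0 x; have := sqr_ge0 (`|x| - 1).
nra.
Qed.

(** This is the third derivative of [ncdf]; its bound is the constant of [ncdf_taylor]. *)
Lemma npdf_deriv2_le x : `|(x ^+ 2 - 1) * npdf x| <= 3.
Proof.
rewrite normrM (ger0_norm (npdf_ge0 x)).
have := npdf_le_inv x; have := npdf_ge0 x; have := sqr_ge0 x.
by case: (ler0P (x ^+ 2 - 1)); nra.
Qed.

(** Used with [c = z * q] and [q ^+ 2 >= 1/2] to bound the second derivative of [ncdf (z * q)] in
    [q]. With [y = z ^+ 2 / 8], the hypothesis gives [npdf c <= expR (- 2 y) <= (1 + y) ^- 2], while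
    [|z| ^+ 3 <= 1 + z ^+ 4 = 1 + 64 y ^+ 2 <= 65 (1 + y) ^+ 2]. *)
Lemma npdf_cubic_le z c : z ^+ 2 <= 2 * c ^+ 2 -> `|z| ^+ 3 * npdf c <= 65.
Proof.
move=> zc; pose y := z ^+ 2 / 8.
have y0 : 0 <= y by rewrite divr_ge0// sqr_ge0.
have npdfc : npdf c * expR (y * 2) <= 1.
  apply: (@le_trans _ _ (expR (- (c ^+ 2 / 2)) * expR (y * 2))).
    by rewrite ler_wpM2r ?expR_ge0 ?npdf_le_exp.
  rewrite -expRD -[leRHS]expR0 ler_expR /y; lra.
have e2 : (1 + y) ^+ 2 <= expR (y * 2).
  rewrite expRM_natr lerXn2r ?nnegrE ?expR_ge0 ?expR_ge1Dx//; lra.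
have z3 : `|z| ^+ 3 <= 1 + 64 * y ^+ 2.
  rewrite (_ : 64 * y ^+ 2 = (`|z| ^+ 2) ^+ 2); last first.
    by rewrite real_normK ?num_real// /y; field.
  have := normr_ge0 z; have [z1|z1] := leP `|z| 1; nra.
have n0 := npdf_ge0 c.
apply: (@le_trans _ _ (65 * (npdf c * expR (y * 2)))); last lra.
rewrite mulrCA mulrC ler_wpM2l//; nra.
Qed.

Lemma ncdf_taylor z (dl : R) :
  `|ncdf (z - dl) - ncdf z + npdf z * dl + z * npdf z * dl ^+ 2 / 2| <= 3 * `|dl| ^+ 3.
Proof.
have dn2 (t : R) : is_derive t (1 : R) (fun x => - x * npdf x) ((t ^+ 2 - 1) * npdf t).
  by apply: is_derive_eq; rewrite /GRing.scale/=; ring.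
have := @taylor2_bound R ncdf npdf _ _ z (z - dl) _
  is_derive_ncdf is_derive_npdf dn2 npdf_deriv2_le.
rewrite (_ : z - dl - z = - dl); last by ring.
rewrite normrN; apply: le_trans.
by rewrite le_eqVlt; apply/orP; left; apply/eqP; congr `|_|; field.
Qed.

(** Expand [ncdf (z * q)] in [q] from 1 to [p = 1 / sqrt (1 + v)], where [p - 1] is [- v / 2] up to
    order [v ^+ 2]. The resulting term [z * npdf z * v / 2] is the one that [ncdf_taylor] yields on
    average for a centred increment of variance [v]: this is the heat equation. *)
Lemma ncdf_scale_taylor z v : 0 <= v <= 1 ->
  `|ncdf (z / Num.sqrt (1 + v)) - ncdf z + z * npdf z * v / 2| <= 70 * v ^+ 2.
Proof.
move=> /andP[v0 v1]; set w := Num.sqrt (1 + v).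
have w2 : w ^+ 2 = 1 + v by rewrite sqr_sqrtr// addr_ge0.
have w0 : 0 <= w by exact: sqrtr_ge0.
have w1 : 1 <= w by rewrite -[leLHS]sqrtr1 ler_wsqrtr// lerDl.
have wle : w <= 1 + v / 2 by rewrite -(@ler_pXn2r _ 2) ?nnegrE//; nra.
pose p := w^-1; have pw : p * w = 1 by rewrite /p mulVf// gt_eqF//; lra.
have p0 : 0 <= p by rewrite /p invr_ge0.
have p1 : p <= 1 by nra.
have pv : p ^+ 2 * (1 + v) = 1 by rewrite -w2 -exprMn pw expr1n.
have p1v : `|p - 1| <= v / 2 by rewrite ler_norml; nra.
have p1v2 : `|p - 1 + v / 2| <= v ^+ 2 by rewrite ler_norml; nra.
pose G q := ncdf (z * q).
have dG (q : R) : is_derive q (1 : R) G (z * npdf (z * q)).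
  by rewrite /G; apply: is_derive_eq; rewrite /GRing.scale/=; ring.
have dG1 (q : R) : is_derive q (1 : R) (fun q => z * npdf (z * q))
    (- (z ^+ 2 * (z * q)) * npdf (z * q)).
  by apply: is_derive_eq; rewrite /GRing.scale/=; ring.
have bG (q : R) : (1 <= q <= p) || (p <= q <= 1) ->
    `|- (z ^+ 2 * (z * q)) * npdf (z * q)| <= 65.
  move=> q1; have pq : p <= q by case/orP: q1 => /andP[]; lra.
  have {q1}q1 : q <= 1 by case/orP: q1 => /andP[]; lra.
  rewrite (_ : _ * _ = - (z ^+ 3 * q * npdf (z * q))); last by ring.
  rewrite normrN (normrM (z ^+ 3 * q)) (normrM (z ^+ 3)) normrX.
  rewrite (ger0_norm (npdf_ge0 _)) (ger0_norm (le_trans p0 pq)).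
  apply: le_trans (@npdf_cubic_le z (z * q) _).
    by rewrite ler_wpM2r ?npdf_ge0// ler_piMr// exprn_ge0.
  (* From [p ^+ 2 * (1 + v) = 1] and [v <= 1], every [q] between [p] and 1 has [2 * q ^+ 2 >= 1]. *)
  rewrite exprMn mulrCA ler_peMr ?sqr_ge0//.
  have : p ^+ 2 <= q ^+ 2 by rewrite lerXn2r// nnegrE; lra.
  nra.
have := taylor1_bound dG dG1 bG.
rewrite /G !mulr1 -/p => H.
rewrite (_ : _ + _ = (ncdf (z * p) - ncdf z - z * npdf z * (p - 1)) +
  z * npdf z * (p - 1 + v / 2)); last by ring.
apply: le_trans (ler_normD _ _) _; rewrite (normrM (z * npdf z)).
have := normrM_npdf_le1 z; have : (p - 1) ^+ 2 <= v ^+ 2.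
  by rewrite -(real_normK (num_real (p - 1))) lerXn2r ?nnegrE//; lra.
have := normr_ge0 (z * npdf z); have := normr_ge0 (p - 1 + v / 2).
nra.
Qed.

End standard_normal.

(** * Independence *)

Section independence.
Context d (T : measurableType d) (R : realType) (P : probability T R).

(** Factorisation on rectangles identifies the joint law of [(U, V)] with the product of the two
    laws, by uniqueness of the product measure. Tonelli on that product gives the iterated
    integral. *)
Lemma indep_integral d1 d2 (T1 : measurableType d1) (T2 : measurableType d2)
    (U : T -> T1) (V : T -> T2) (F : T1 * T2 -> \bar R) :
  measurable_fun setT U -> measurable_fun setT V ->
  (forall A B, measurable A -> measurable B ->
    P (U @^-1` A `&` V @^-1` B) = (P (U @^-1` A) * P (V @^-1` B))%E) ->
  measurable_fun setT F -> (forall z, 0 <= F z)%E ->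
  (\int[P]_w F (U w, V w) = \int[P]_w \int[P]_w' F (U w, V w'))%E.
Proof.
move=> mU mV UV mF F0.
pose UM := isMeasurableFun.Build _ _ _ _ _ mU.
pose U' : {mfun T >-> T1} := HB.pack U UM.
pose VM := isMeasurableFun.Build _ _ _ _ _ mV.
pose V' : {mfun T >-> T2} := HB.pack V VM.
have mUV : measurable_fun setT (fun w => (U w, V w)) by exact: measurable_fun_pair.
pose UVM := isMeasurableFun.Build _ _ _ _ _ mUV.
pose UV' : {mfun T >-> (T1 * T2)%type} := HB.pack (fun w => (U w, V w)) UVM.
pose PU : probability T1 R := distribution P U'.
pose PV : probability T2 R := distribution P V'.
pose PUV : probability (T1 * T2)%type R := distribution P UV'.
have PUVE A : measurable A -> (PU \x PV)%E A = PUV A.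
  by move=> mA; apply: product_measure_unique => // B C mB mC; exact: UV.
transitivity (\int[PUV]_z F z)%E; first by rewrite ge0_integral_distribution.
transitivity (\int[PU \x PV]_z F z)%E.
  by apply: eq_measure_integral => A mA _; exact/esym/PUVE.
rewrite fubini_tonelli1//= /fubini_F ge0_integral_distribution//=.
- apply: eq_integral => w _ /=.
  by rewrite ge0_integral_distribution//; exact: measurableT_comp.
- exact: measurable_fun_fubini_tonelli_F.
- by move=> y; exact: integral_ge0.
Qed.

(** The finite intersections of events on single [X i], [i < j], form a class [G] closed under
    intersection. With [C] the event on [X j], the finite measures [E |-> P (E & C)] and
    [E |-> P C * P E] agree on [G], hence on the sigma-algebra it generates, which contains the
    events of [S]. *)
Lemma indep_partial_sum (X : nat -> {RV P >-> R}) (q : R -> R) (j : nat) (A B : set R) :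
  mutually_independent X -> measurable_fun setT q ->
  measurable A -> measurable B ->
  let S w := \sum_(i < j) q (X i w) in
  P (S @^-1` A `&` X j @^-1` B) = (P (S @^-1` A) * P (X j @^-1` B))%E.
Proof.
move=> indX mq mA mB S.
pose J : {fset nat} := [fset i in iota 0 j]%fset.
have JE i : (i \in J) = (i < j)%N by rewrite !inE mem_iota.
pose G : set (set T) := [set E | exists2 A' : nat -> set R,
  (forall i, measurable (A' i)) & E = \bigcap_(i in [set` J]) (X i @^-1` A' i)].
have mX i (C : set R) : measurable C -> measurable (X i @^-1` C).
  by move=> mC; rewrite -[X in measurable X]setTI; exact: measurable_funPT.
have GX i C : (i < j)%N -> measurable C -> G (X i @^-1` C).
  move=> ij mC; exists (fun k => if k == i then C else setT).
    by move=> k; case: ifP.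
  apply/seteqP; split => [w Cw k _/=|w /(_ i)/=]; last by rewrite JE eqxx; exact.
  by case: eqP => [->|].
pose C := X j @^-1` B.
have mC : measurable C by exact: mX.
have PCfin : P C \is a fin_num by exact: fin_num_measure.
pose r : {nonneg R} := NngNum (fine_ge0 (measure_ge0 P C)).
have rE : r%:num%:E = P C by rewrite /r/= fineK.
suff main E : <<s G >> E -> P (E `&` C) = (P E * P C)%E.
  apply: main.
  pose GT := g_sigma_algebraType G.
  have mS : measurable_fun (setT : set GT) (S : GT -> R).
    apply: measurable_sum => i; apply: measurableT_comp => //.
    move=> _ D mD; rewrite setTI; apply: sub_sigma_algebra.
    by apply: GX => //; exact: ltn_ord.
  by have := mS measurableT A mA; rewrite setTI.
move=> GE; rewrite muleC -rE -[LHS]/(mrestr P mC E) -[RHS]/(mscale r P E).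
apply: (g_sigma_algebra_measure_unique G _ (fun=> setT)) GE.
- by move=> _ [A' mA' ->]; apply: fin_bigcap_measurable => // i _; exact: mX.
- by move=> _; exists (fun=> setT) => //; apply/esym/seteqP; split => // w _ i _.
- by apply/seteqP; split => // w _; exists 0%N.
- move=> _ _ [A1 mA1 ->] [A2 mA2 ->]; exists (fun i => A1 i `&` A2 i).
    by move=> i; exact: measurableI.
  by rewrite -bigcapI.
- move=> _ [A' mA' ->]; rewrite /= /mrestr /mscale rE.
  pose A2 i := if i == j then B else A' i.
  have mA2 i : measurable (A2 i) by rewrite /A2; case: ifP.
  have jJ : j \notin J by rewrite JE ltnn.
  have A2E i : i \in J -> A2 i = A' i.
    by rewrite JE /A2; case: eqP => // ->; rewrite ltnn.
  transitivity (P (\bigcap_(i in [set` (j |` J)%fset]) (X i @^-1` A2 i))).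
    congr (P _); apply/seteqP; split => [w [Jw Cw] i /=|w Jw].
      rewrite in_fset1U => /orP[/eqP ->|iJ]; first by rewrite /A2 eqxx.
      by rewrite A2E//; exact: Jw.
    split=> [i /= iJ|].
      by rewrite -A2E//; apply: Jw; rewrite /= in_fset1U iJ orbT.
    by have := Jw j; rewrite /= in_fset1U eqxx /A2 eqxx; exact.
  transitivity (P C * \prod_(i <- J) P (X i @^-1` A' i))%E; last first.
    by congr (_ * _)%E; exact/esym/indX.
  rewrite indX// big_fsetU1//= /A2 eqxx; congr (_ * _)%E.
  by rewrite big_seq [RHS]big_seq; apply: eq_bigr => i iJ; rewrite -/(A2 i) A2E.
- by move=> _; rewrite /= /mrestr (le_lt_trans (probability_le1 _ _)) ?ltry//; exact: measurableI.
Qed.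

End independence.

(** * Central limit theorem for bounded triangular arrays *)

Section clt.
Context d (T : measurableType d) (R : realType) (P : probability T R).

Lemma bounded_integrable (f : T -> R) K : measurable_fun setT f ->
  (forall w, `|f w| <= K) -> P.-integrable setT (EFin \o f).
Proof.
move=> mf fK; apply: measurable_bounded_integrable => //.
  by rewrite (le_lt_trans (probability_le1 _ _)) ?ltry.
by exists K; split; [exact: num_real|move=> x Kx w _; exact: le_trans (fK w) (ltW Kx)].
Qed.

Lemma Rintegral_probability_cst (r : R) : \int[P]_w r = r.
Proof. by rewrite Rintegral_cst// [X in fine X]probability_setT mulr1. Qed.

Lemma normr_Rintegral_le (f : T -> R) K : measurable_fun setT f ->
  (forall w, `|f w| <= K) -> `|\int[P]_w f w| <= K.
Proof.
move=> mf fK; have intf := bounded_integrable mf fK.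
apply: le_trans (le_normr_Rintegral _ intf) _ => //.
rewrite -[leRHS]Rintegral_probability_cst; apply: le_Rintegral => //.
  exact: integrable_norm.
by apply: (@bounded_integrable (cst K) `|K|).
Qed.

(** Adding [K] makes the integrand nonnegative, so that [indep_integral] and the measurability part
    of Tonelli apply; the constant is subtracted again at the end. *)
Lemma indep_expectation d1 d2 (T1 : measurableType d1) (T2 : measurableType d2)
    (U : T -> T1) (V : T -> T2) (F : T1 * T2 -> R) K :
  measurable_fun setT U -> measurable_fun setT V ->
  (forall A B, measurable A -> measurable B ->
    P (U @^-1` A `&` V @^-1` B) = (P (U @^-1` A) * P (V @^-1` B))%E) ->
  measurable_fun setT F -> (forall z, `|F z| <= K) ->
  measurable_fun setT (fun w => \int[P]_w' F (U w, V w')) /\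
  \int[P]_w F (U w, V w) = \int[P]_w \int[P]_w' F (U w, V w').
Proof.
move=> mU mV UV mF FK.
pose G z := F z + K.
have mG : measurable_fun setT G by exact: measurable_funD.
have G0 z : 0 <= G z by have := FK z; rewrite ler_norml /G; lra.
have mGU w : measurable_fun setT (fun w' => F (U w, V w')).
  by apply: measurableT_comp => //; exact: measurable_fun_pair.
have intF w : P.-integrable setT (EFin \o fun w' => F (U w, V w')).
  by apply: (@bounded_integrable _ K).
have intK : P.-integrable setT (EFin \o (cst K : T -> R)).
  by apply: (@bounded_integrable _ `|K|).
have addK (f : T -> R) : P.-integrable setT (EFin \o f) ->
    (\int[P]_w (f w + K)%:E)%E = (\int[P]_w f w + K)%:E.
  move=> intf; under eq_integral do rewrite EFinD.
  rewrite EFinD integralD//; congr +%E.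
    by rewrite /Rintegral fineK//; exact: (integrable_fin_num _ intf).
  by rewrite integral_cst//= probability_setT mule1.
have innerE w : (\int[P]_w' (G (U w, V w'))%:E)%E =
    (\int[P]_w' F (U w, V w') + K)%:E by exact: addK.
have mI : measurable_fun setT (fun w => \int[P]_w' F (U w, V w')).
  have : measurable_fun setT (fun w => (\int[P]_w' (G (U w, V w'))%:E)%E).
    pose H (z : T * T) := (G (U z.1, V z.2))%:E.
    apply: (@measurable_fun_fubini_tonelli_F _ _ _ _ R P H) => //.
      apply/measurable_EFinP; apply: measurableT_comp => //.
      by apply: measurable_fun_pair; exact: measurableT_comp.
    by move=> z; rewrite lee_fin.
  under eq_fun do rewrite innerE.
  move=> /measurable_EFinP mIK.
  rewrite (_ : (fun w => _) = fun w => (\int[P]_w' F (U w, V w') + K) - K).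
    exact: measurable_funB.
  by apply/funext => w; rewrite addrK.
split => //.
have mUV : measurable_fun setT (fun w => F (U w, V w)).
  by apply: measurableT_comp => //; exact: measurable_fun_pair.
have mEG : measurable_fun setT (EFin \o G) by exact/measurable_EFinP.
have := indep_integral mU mV UV mEG (fun z => G0 z).
under [in RHS]eq_integral do rewrite /= innerE.
rewrite /= addK; last exact: (bounded_integrable mUV).
rewrite addK; last first.
  apply: (bounded_integrable mI) => w.
  by apply: normr_Rintegral_le => // w'; exact: FK.
by move=> -[] /addIr.
Qed.

Lemma identically_distributed_Rintegral (X : nat -> {RV P >-> R}) (f : R -> R) (K : R) i j :
  identically_distributed X -> measurable_fun setT f -> (forall x, `|f x| <= K) ->
  \int[P]_w f (X i w) = \int[P]_w f (X j w).
Proof.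
move=> idX mf fK.
have E k : (\int[P]_w (f (X k w))%:E = \int[distribution P (X k)]_x (f x)%:E)%E.
  rewrite integral_distribution//; first exact/measurable_EFinP.
  apply: (@bounded_integrable (f \o X k) K); last by move=> w /=.
  exact: measurableT_comp.
rewrite /Rintegral !E; congr fine; apply: eq_measure_integral => A mA _; exact: idX.
Qed.

(* A centred increment of variance v acts on ncdf, up to third order and
   uniformly in the position, like Gaussian smoothing of variance v. *)
Lemma smoothing_step_unit (V : T -> R) (kap z : R) :
  measurable_fun setT V -> (forall w, `|V w| <= kap) -> kap <= 1 ->
  \int[P]_w V w = 0 ->
  `|\int[P]_w ncdf (z - V w) - ncdf (z / Num.sqrt (1 + \int[P]_w (V w ^+ 2)))|
    <= 73 * kap ^+ 3.
Proof.
move=> mV Vk k1 EV0; set v := \int[P]_w (V w ^+ 2).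
have [w0 _] : exists w0 : T, True by exists point.
have k0 : 0 <= kap by exact: le_trans (Vk w0).
have V2 w : `|V w ^+ 2| <= kap ^+ 2.
  by rewrite normrX lerXn2r ?nnegrE.
have mV2 : measurable_fun setT (fun w => V w ^+ 2) by exact: measurable_funX.
have v0 : 0 <= v by apply: Rintegral_ge0 => w _; exact: sqr_ge0.
have vk : v <= kap ^+ 2 by have := normr_Rintegral_le mV2 V2; rewrite ger0_norm.
have mn : measurable_fun setT (fun w => ncdf (z - V w)).
  by apply: (measurableT_comp measurable_ncdf); exact: measurable_funB.
have nb w : `|ncdf (z - V w)| <= 1 by rewrite ger0_norm ?ncdf_ge0 ?ncdf_le1.
have i1 := bounded_integrable mn nb.
have i2 : P.-integrable setT (EFin \o fun w => npdf z * V w).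
  apply: (@bounded_integrable _ (npdf z * kap)); first exact: measurable_funM.
  by move=> w; rewrite normrM (ger0_norm (npdf_ge0 z)) ler_wpM2l ?npdf_ge0.
have i3 : P.-integrable setT (EFin \o fun w => z * npdf z / 2 * V w ^+ 2).
  apply: (@bounded_integrable _ (`|z * npdf z / 2| * kap ^+ 2)); first exact: measurable_funM.
  by move=> w; rewrite normrM ler_wpM2l.
have i4 : P.-integrable setT (EFin \o fun=> ncdf z).
  by apply: (@bounded_integrable (cst (ncdf z)) `|ncdf z|).
have i14 : P.-integrable setT (EFin \o fun w => ncdf (z - V w) - ncdf z).
  exact: (integrableB measurableT i1 i4).
have i142 : P.-integrable setT (EFin \o fun w => ncdf (z - V w) - ncdf z + npdf z * V w).
  exact: (integrableD measurableT i14 i2).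
have E : \int[P]_w (ncdf (z - V w) - ncdf z + npdf z * V w + z * npdf z / 2 * V w ^+ 2) =
    \int[P]_w ncdf (z - V w) - ncdf z + z * npdf z * v / 2.
  rewrite RintegralD//.
  rewrite RintegralD//.
  rewrite RintegralB// Rintegral_probability_cst.
  rewrite RintegralZl//; last exact: (bounded_integrable mV Vk).
  rewrite RintegralZl//; last exact: (bounded_integrable mV2 V2).
  by rewrite EV0 -/v; field.
have B1 : `|\int[P]_w ncdf (z - V w) - ncdf z + z * npdf z * v / 2| <= 3 * kap ^+ 3.
  rewrite -E; apply: normr_Rintegral_le => [|w].
    apply: measurable_funD; last exact: measurable_funM.
    by apply: measurable_funD; [exact: measurable_funB|exact: measurable_funM].
  rewrite -(mulrAC (z * npdf z)); apply: le_trans (ncdf_taylor z (V w)) _.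
  by rewrite ler_wpM2l// lerXn2r ?nnegrE.
have v01 : 0 <= v <= 1 by rewrite v0 (le_trans vk)// exprn_ile1.
have B2 := ncdf_scale_taylor z v01.
(* The terms [z * npdf z * v / 2] of the two expansions cancel, leaving [3 kap ^+ 3 + 70 v ^+ 2]. As
   [v <= kap ^+ 2] and [kap <= 1], this is at most [73 kap ^+ 3]. *)
have v2 : v ^+ 2 <= kap ^+ 3.
  apply: (@le_trans _ _ ((kap ^+ 2) ^+ 2)); first by rewrite lerXn2r ?nnegrE ?sqr_ge0.
  by rewrite -exprM; apply: ler_wiXn2l.
rewrite (_ : _ - _ = (\int[P]_w ncdf (z - V w) - ncdf z + z * npdf z * v / 2) -
   (ncdf (z / Num.sqrt (1 + v)) - ncdf z + z * npdf z * v / 2)); last by ring.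
apply: le_trans (ler_normB _ _) _; lra.
Qed.

Lemma mulr_sqrt1D (t v : R) : 0 < t ->
  t * Num.sqrt (1 + v / t ^+ 2) = Num.sqrt (t ^+ 2 + v).
Proof.
move=> t0; rewrite -{1}(gtr0_norm t0) -sqrtr_sqr -sqrtrM ?sqr_ge0//.
by congr Num.sqrt; field; rewrite gt_eqF.
Qed.

(** By independence [U] may be frozen while [V] is averaged. Dividing by [tau] then reduces to
    [smoothing_step_unit] at the position [(b - U w) / tau], uniformly in [w]. *)
Lemma smoothing_step (U V : T -> R) (kap tau b : R) :
  measurable_fun setT U -> measurable_fun setT V ->
  (forall A B : set R, measurable A -> measurable B ->
    P (U @^-1` A `&` V @^-1` B) = (P (U @^-1` A) * P (V @^-1` B))%E) ->
  (forall w, `|V w| <= kap) -> 0 < tau -> kap <= tau -> \int[P]_w V w = 0 ->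
  `|\int[P]_w ncdf ((b - (U w + V w)) / tau) -
    \int[P]_w ncdf ((b - U w) / Num.sqrt (tau ^+ 2 + \int[P]_w' (V w' ^+ 2)))|
    <= 73 * (kap / tau) ^+ 3.
Proof.
move=> mU mV UV Vk tau0 ktau EV0; set v := \int[P]_w' (V w' ^+ 2).
have mncdf := @measurable_ncdf R.
pose F (z : R * R) := ncdf ((b - (z.1 + z.2)) / tau).
have mF : measurable_fun setT F.
  apply: measurableT_comp => //; apply: measurable_funM => //.
  by apply: measurable_funB => //; exact: measurable_funD.
have nb (z : R) : `|ncdf z| <= 1 by rewrite ger0_norm ?ncdf_ge0 ?ncdf_le1.
have [mI ->] := indep_expectation mU mV UV mF (fun z => nb _).
have mn : measurable_fun setT (fun w => ncdf ((b - U w) / Num.sqrt (tau ^+ 2 + v))).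
  apply: measurableT_comp => //; apply: measurable_funM => //.
  exact: measurable_funB.
have bI w : `|\int[P]_w' F (U w, V w')| <= 1.
  apply: normr_Rintegral_le => // [|w']; last exact: nb.
  by apply: measurableT_comp => //; exact: measurable_fun_pair.
rewrite -RintegralB//; [|exact: (bounded_integrable mI bI)
                       |exact: (bounded_integrable mn (fun w => nb _))].
apply: normr_Rintegral_le => [|w]; first exact: measurable_funB.
pose V' w := V w / tau.
have mV' : measurable_fun setT V' by exact: measurable_funM.
have V'k w' : `|V' w'| <= kap / tau.
  by rewrite normrM normfV (gtr0_norm tau0) ler_wpM2r// invr_ge0 ltW.
have kt1 : kap / tau <= 1 by rewrite ler_pdivrMr// mul1r.
have EV'0 : \int[P]_w V' w = 0.
  by rewrite RintegralZr// ?EV0 ?mul0r//; exact: (bounded_integrable mV Vk).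
have E2 : \int[P]_w (V' w ^+ 2) = v / tau ^+ 2.
  rewrite -RintegralZr//; first by apply: eq_Rintegral => w' _; rewrite exprMn exprVn.
  apply: (@bounded_integrable _ (kap ^+ 2)); first exact: measurable_funX.
  by move=> w'; rewrite normrX lerXn2r ?nnegrE// (le_trans _ (Vk w')).
have := smoothing_step_unit ((b - U w) / tau) mV' V'k kt1 EV'0.
have e1 : \int[P]_w' ncdf ((b - U w) / tau - V' w') = \int[P]_w' F (U w, V w').
  by apply: eq_Rintegral => w' _; congr ncdf; rewrite /V' /=; field; rewrite gt_eqF.
have e2 : (b - U w) / tau / Num.sqrt (1 + v / tau ^+ 2) =
    (b - U w) / Num.sqrt (tau ^+ 2 + v).
  rewrite -mulrA -invfM; congr (_ / _).
  exact: mulr_sqrt1D.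
by rewrite E2 e1 e2.
Qed.

(** Induction on [n] with [tau] varying: the last summand is independent of the partial sum before
    it and is traded for an increase of [tau ^+ 2] by its variance. Since the scale only grows,
    every step costs at most the error at the initial [tau]. *)
Lemma lindeberg_smooth (X : nat -> {RV P >-> R}) (q : R -> R) (kap tau b : R) (n : nat) :
  iid X -> measurable_fun setT q -> (forall x, `|q x| <= kap) ->
  0 < tau -> kap <= tau -> \int[P]_w q (X 0%N w) = 0 ->
  `|\int[P]_w ncdf ((b - \sum_(i < n) q (X i w)) / tau) -
    ncdf (b / Num.sqrt (tau ^+ 2 + n%:R * \int[P]_w (q (X 0%N w) ^+ 2)))|
    <= n%:R * (73 * (kap / tau) ^+ 3).
Proof.
move=> [indX idX] mq qk + + Eq0; set v := \int[P]_w (q (X 0%N w) ^+ 2).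
have k0 : 0 <= kap by exact: le_trans (qk 0).
have v0 : 0 <= v by apply: Rintegral_ge0 => w _; exact: sqr_ge0.
have mqX i : measurable_fun setT (fun w => q (X i w)) by exact: measurableT_comp.
elim: n tau => [|n IH] tau tau0 ktau.
  rewrite !mul0r addr0 sqrtr_sqr (gtr0_norm tau0).
  under eq_Rintegral do rewrite big_ord0 subr0.
  by rewrite Rintegral_probability_cst subrr normr0.
pose S w := \sum_(i < n) q (X i w).
have mS : measurable_fun setT S by exact: measurable_sum.
pose tau' := Num.sqrt (tau ^+ 2 + v).
have tau'2 : tau' ^+ 2 = tau ^+ 2 + v by rewrite sqr_sqrtr// addr_ge0// sqr_ge0.
have ttau' : tau <= tau'.
  by rewrite -(gtr0_norm tau0) -sqrtr_sqr ler_wsqrtr// lerDl.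
have tau'0 : 0 < tau' by exact: lt_le_trans ttau'.
have Eqn : \int[P]_w q (X n w) = 0.
  by rewrite (identically_distributed_Rintegral n 0 idX mq qk).
have vE : \int[P]_w (q (X n w) ^+ 2) = v.
  apply: (@identically_distributed_Rintegral X (fun x => q x ^+ 2) (kap ^+ 2) n 0 idX).
    exact: measurable_funX.
  by move=> x; rewrite normrX lerXn2r ?nnegrE.
have step := @smoothing_step S (fun w => q (X n w)) kap tau b mS (mqX n) _
  (fun w => qk _) tau0 ktau Eqn.
have mqB (B : set R) : measurable B -> measurable (q @^-1` B).
  by move=> mB; rewrite -[X in measurable X]setTI; exact: mq.
have {}step := step (fun A B mA mB => indep_partial_sum n indX mq mA (mqB _ mB)).
have IH' := IH tau' tau'0 (le_trans ktau ttau').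
have tau'n : tau' ^+ 2 + n%:R * v = tau ^+ 2 + n.+1%:R * v.
  by rewrite tau'2 -natr1; ring.
rewrite tau'n in IH'.
under [X in `|X - _|]eq_Rintegral do rewrite big_ord_recr/=.
rewrite [X in `|X - _|](_ : _ = \int[P]_w ncdf ((b - (S w + q (X n w))) / tau))//.
rewrite vE -/tau' in step.
set e0 := \int[P]_w ncdf ((b - (S w + q (X n w))) / tau) in step *.
set e1 := \int[P]_w ncdf ((b - S w) / tau') in step IH'.
set e2 := ncdf _ in IH' *.
rewrite (_ : e0 - e2 = (e0 - e1) + (e1 - e2)); last by ring.
apply: le_trans (ler_normD _ _) _.
rewrite [in leRHS]mulrSr mulrDl mul1r addrC; apply: lerD => //.
apply: le_trans IH' _; rewrite ler_wpM2l// ler_wpM2l//.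
have kk : kap / tau' <= kap / tau by rewrite ler_wpM2l// lef_pV2 ?posrE.
by rewrite lerXn2r// nnegrE divr_ge0// ltW.
Qed.

(** The indicator of [W <= a] lies between two shifted copies of [ncdf], up to a Gaussian tail: on
    [W > a] the lower copy is at most [ncdf (- eta / tau)], and on [W <= a] the upper one is at
    least [ncdf (eta / tau)]. *)
Lemma cdf_smoothing (W : T -> R) (a eta tau : R) : measurable_fun setT W -> 0 < tau ->
  \int[P]_w ncdf ((a - eta - W w) / tau) - ncdf (- eta / tau) <=
    fine (P (W @^-1` `]-oo, a])) <=
  \int[P]_w ncdf ((a + eta - W w) / tau) + (1 - ncdf (eta / tau)).
Proof.
move=> mW tau0.
pose A := W @^-1` `]-oo, a].
have mA : measurable A.
  by rewrite -[A]setTI; exact: mW.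
have PE : fine (P (W @^-1` `]-oo, a])) = \int[P]_w \1_A w.
  by rewrite /Rintegral integral_indic// setIT.
have iA : P.-integrable setT (EFin \o \1_A).
  apply: (@bounded_integrable _ 1); first exact: measurable_indic.
  by move=> w; rewrite indicE ger0_norm// lern1 leq_b1.
have mn (b : R) : measurable_fun setT (fun w => ncdf ((b - W w) / tau)).
  apply: (measurableT_comp measurable_ncdf).
  by apply: measurable_funM => //; exact: measurable_funB.
have nb (z : R) : `|ncdf z| <= 1 by rewrite ger0_norm ?ncdf_ge0 ?ncdf_le1.
have iN (b c : R) : P.-integrable setT (EFin \o fun w => ncdf ((b - W w) / tau) + c).
  apply: (@bounded_integrable _ (1 + `|c|)); first exact: measurable_funD.
  by move=> w; rewrite (le_trans (ler_normD _ _))// lerD.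
have iE (b c : R) : \int[P]_w ncdf ((b - W w) / tau) + c =
    \int[P]_w (ncdf ((b - W w) / tau) + c).
  rewrite RintegralD// ?Rintegral_probability_cst//.
    exact: (bounded_integrable (mn b) (fun w => nb _)).
  by apply: (@bounded_integrable (cst c) `|c|).
have lo : \int[P]_w (ncdf ((a - eta - W w) / tau) - ncdf (- eta / tau)) <= \int[P]_w \1_A w.
  apply: le_Rintegral; [exact: measurableT|exact: iN|exact: iA|move=> w _; rewrite indicE].
  have [Aw|Aw] := boolP (w \in A).
    rewrite -[leRHS]subr0 lerB ?ncdf_ge0//.
    by rewrite -[leRHS]/1 ncdf_le1.
  rewrite -[leRHS]/0 lerBlDr add0r ncdf_nondecreasing// ler_pM2r ?invr_gt0//.
  move: Aw; rewrite notin_setE /A/= in_itv/= => /negP; rewrite -ltNge; lra.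
have hi : \int[P]_w \1_A w <= \int[P]_w (ncdf ((a + eta - W w) / tau) + (1 - ncdf (eta / tau))).
  apply: le_Rintegral; [exact: measurableT|exact: iA|exact: iN|move=> w _; rewrite indicE].
  have [Aw|Aw] := boolP (w \in A); last first.
    by rewrite addr_ge0 ?ncdf_ge0// subr_ge0 ncdf_le1.
  rewrite -[leLHS]/1 addrCA lerDl subr_ge0.
  rewrite ncdf_nondecreasing// ler_pM2r ?invr_gt0//.
  move: Aw; rewrite inE /A/= in_itv/=; lra.
rewrite PE; apply/andP; split; [rewrite -iE in lo; exact: lo|rewrite -iE in hi; exact: hi].
Qed.

(** Here [x] plays the shift [eta] of [cdf_smoothing], [c] is its sign, and [x ^+ 4] is the
    smoothing variance for the scale [tau = eta ^+ 2]. *)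
Lemma ncdf_shift_cvg (a s c : R) : 0 < s ->
  ncdf ((a + c * x) / Num.sqrt (x ^+ 4 + s ^+ 2)) @[x --> 0^'+] --> ncdf (a / s).
Proof.
move=> s0; apply: cvg_at_right_filter.
have -> : ncdf (a / s) = ncdf ((a + c * 0) / Num.sqrt (0 ^+ 4 + s ^+ 2)).
  by rewrite mulr0 addr0 expr0n/= add0r sqrtr_sqr gtr0_norm.
apply: (@continuous_comp _ _ _ (fun x : R => (a + c * x) / Num.sqrt (x ^+ 4 + s ^+ 2)) (@ncdf R)).
  apply: cvgM; first by apply: cvgD; [exact: cvg_cst|apply: cvgM; [exact: cvg_cst|exact: cvg_id]].
  apply: cvgV; first by rewrite expr0n/= add0r sqrtr_sqr gtr0_norm// gt_eqF.
  apply: (@continuous_comp _ _ _ (fun x : R => x ^+ 4 + s ^+ 2) (@Num.sqrt R)).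
    by apply: cvgD; [exact: exprn_continuous|exact: cvg_cst].
  exact: sqrt_continuous.
exact: continuous_ncdf.
Qed.

(** The final error count of [bounded_array_clt]: [pn] is the probability, the [x] are the smoothed
    expectations, the [y] their Gaussian values, the [z] tail values of [ncdf], [u] the limit and
    [er] the Lindeberg error. *)
Let squeeze_arith (e pn x1 x2 y1 y2 z1 z2 z3 z4 u er : R) :
  x1 - z1 <= pn -> pn <= x2 + (1 - z4) ->
  - er <= x1 - y1 -> x1 - y1 <= er -> - er <= x2 - y2 -> x2 - y2 <= er ->
  - (e / 2) <= u - y1 -> u - y1 <= e / 2 ->
  - (e / 2) <= u - y2 -> u - y2 <= e / 2 ->
  z3 <= z4 -> z1 <= z2 -> 1 - z3 <= e / 4 -> z2 <= e / 4 -> er <= e / 4 ->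
  - e <= u - pn <= e.
Proof. by move=> *; lra. Qed.

Lemma near_div_sqrt_le (c dl : R) : 0 < dl ->
  \forall n \near \oo, c / Num.sqrt n%:R <= dl.
Proof.
move=> dl0.
have sqrty : Num.sqrt n%:R^-1 @[n --> \oo] --> (0 : R).
  rewrite -(@sqrtr0 R); apply: continuous_cvg; first exact: sqrt_continuous.
  apply/gtr0_cvgV0; last exact: cvgr_idn.
  by near=> n; rewrite ltr0n; near: n; exists 1%N.
have : c * Num.sqrt n%:R^-1 @[n --> \oo] --> c * (0 : R) by apply: cvgM => //; exact: cvg_cst.
rewrite mulr0 => /cvgrPdist_le /(_ _ dl0); apply: filterS => n.
by rewrite sqrtrV// sub0r normrN => /(le_trans (ler_norm _)).
Unshelve. all: by end_near. Qed.

(** The probability is sandwiched by [cdf_smoothing]. For fixed [eta] the smoothed expectations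
    converge as [n] grows; [eta] is chosen small beforehand, so that smoothing and shift cost
    little. *)
Lemma bounded_array_clt (X : nat -> {RV P >-> R}) (q : nat -> R -> R) (K s a : R) :
  iid X -> (forall n, measurable_fun setT (q n)) -> (forall n x, `|q n x| <= K) ->
  (forall n, \int[P]_w q n (X 0%N w) = 0) -> 0 < s ->
  \int[P]_w (q n (X 0%N w) ^+ 2) @[n --> \oo] --> s ^+ 2 ->
  P ((fun w => (Num.sqrt n%:R)^-1 * \sum_(i < n) q n (X i w)) @^-1` `]-oo, a])
    @[n --> \oo] --> (ncdf (a / s))%:E.
Proof.
move=> iidX mq qK Eq0 s0 cvs.
pose W n w := (Num.sqrt n%:R)^-1 * \sum_(i < n) q n (X i w).
have mW n : measurable_fun setT (W n).
  apply: measurable_funM => //; apply: measurable_sum => i.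
  exact: measurableT_comp.
pose v n := \int[P]_w (q n (X 0%N w) ^+ 2).
have K0 : 0 <= K by exact: le_trans (qK 0%N 0).
(* [lindeberg_smooth] for the increments [q n / sqrt n]: the sum of [n] errors of order [n ^ (-3/2)]
   is of order [1 / sqrt n]. *)
have smooth n b tau : (0 < n)%N -> 0 < tau -> K / Num.sqrt n%:R <= tau ->
    `|\int[P]_w ncdf ((b - W n w) / tau) - ncdf (b / Num.sqrt (tau ^+ 2 + v n))| <=
    73 * (K / tau) ^+ 3 / Num.sqrt n%:R.
  move=> n0 tau0 Kn.
  have sn0 : 0 < Num.sqrt n%:R :> R by rewrite sqrtr_gt0 ltr0n.
  have sn2 : n%:R = Num.sqrt n%:R ^+ 2 :> R by rewrite sqr_sqrtr.
  pose q' x := (Num.sqrt n%:R)^-1 * q n x.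
  have mq' : measurable_fun setT q' by exact: measurable_funM.
  have q'K x : `|q' x| <= K / Num.sqrt n%:R.
    by rewrite normrM mulrC normfV (gtr0_norm sn0) ler_pM2r ?invr_gt0.
  have mqX : measurable_fun setT (fun w => q n (X 0%N w)) by exact: measurableT_comp.
  have Eq' : \int[P]_w q' (X 0%N w) = 0.
    rewrite RintegralZl//; first by rewrite Eq0 mulr0.
    exact: (bounded_integrable mqX (fun w => qK n _)).
  have := lindeberg_smooth b n iidX mq' q'K tau0 Kn Eq'.
  have -> : n%:R * \int[P]_w q' (X 0%N w) ^+ 2 = v n.
    under eq_Rintegral do rewrite exprMn.
    rewrite RintegralZl//; last first.
      apply: (@bounded_integrable _ (K ^+ 2)); first exact: measurable_funX.
      by move=> w; rewrite normrX lerXn2r ?nnegrE.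
    by rewrite exprVn -sn2 mulVKf// pnatr_eq0 -lt0n.
  have -> : \int[P]_w ncdf ((b - \sum_(i < n) q' (X i w)) / tau) =
      \int[P]_w ncdf ((b - W n w) / tau).
    by apply: eq_Rintegral => w _; rewrite /W mulr_sumr.
  move=> /le_trans; apply; rewrite {1}sn2 le_eqVlt; apply/orP; left; apply/eqP.
  by field; rewrite !gt_eqF.
pose p n := fine (P (W n @^-1` `]-oo, a])).
have pE n : P (W n @^-1` `]-oo, a]) = (p n)%:E.
  by rewrite /p fineK// fin_num_measure// -[X in measurable X]setTI; exact: mW.
under eq_fun do rewrite -/(W _) pE.
apply/cvg_EFin; first by apply: nearW => n.
apply/cvgrPdist_le => e e0; rewrite /=.
have e4 : 0 < e / 4 by rewrite divr_gt0.
have [M M0 [HM HM']] : exists2 M : R, 0 < M & (1 - ncdf M <= e / 4 /\ ncdf (- M) <= e / 4).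
  near (+oo : set_system R) => M; exists M; first by [].
  split.
    apply: le_trans (ler_norm _) _; near: M.
    by move/cvgrPdist_le: (@ncdf_cvgy R); exact.
  apply: le_trans (ler_norm _) _; rewrite -normrN -sub0r; near: M.
  by have := @ncdf_cvgNy R; rewrite cvgNy_compNP => /cvgrPdist_le; exact.
near (0 : R)^'+ => eta.
have eta0 : 0 < eta by [].
have etaM : M <= eta^-1.
  rewrite -[M]invrK lef_pV2 ?posrE ?invr_gt0//.
  by near: eta; apply: nbhs_right_le; rewrite invr_gt0.
have lim_pm c : `|ncdf (a / s) - ncdf ((a + c * eta) / Num.sqrt (eta ^+ 4 + s ^+ 2))| <= e / 4 ->
    \forall n \near \oo,
      `|ncdf (a / s) - ncdf ((a + c * eta) / Num.sqrt (eta ^+ 4 + v n))| <= e / 2.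
  move=> H.
  have : ncdf ((a + c * eta) / Num.sqrt (eta ^+ 4 + v n)) @[n --> \oo] -->
      ncdf ((a + c * eta) / Num.sqrt (eta ^+ 4 + s ^+ 2)).
    apply: continuous_cvg; first exact: continuous_ncdf.
    apply: cvgM; first exact: cvg_cst.
    apply: cvgV; first by rewrite gt_eqF// sqrtr_gt0 ltr_wpDl ?exprn_gt0// ltW// exprn_gt0.
    apply: continuous_cvg; first exact: sqrt_continuous.
    by apply: cvgD; [exact: cvg_cst|].
  move/cvgrPdist_le => /(_ _ e4); apply: filterS => n Hn.
  rewrite -(subrK (ncdf ((a + c * eta) / Num.sqrt (eta ^+ 4 + s ^+ 2))) (ncdf (a / s))) -addrA.
  by rewrite (le_trans (ler_normD _ _))// (le_trans (lerD H Hn))// -mulrDr; lra.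
(* The scale must be small compared with the shift: now [eta / tau = eta^-1 >= M], so both tails in
   [cdf_smoothing] are at most [e / 4]. *)
pose tau := eta ^+ 2.
have tau0 : 0 < tau by rewrite exprn_gt0.
near=> n.
have n0 : (0 < n)%N by near: n; exists 1%N.
have Kn : K / Num.sqrt n%:R <= tau by near: n; exact: near_div_sqrt_le.
have err : 73 * (K / tau) ^+ 3 / Num.sqrt n%:R <= e / 4 by near: n; exact: near_div_sqrt_le.
have /andP[lo hi] := cdf_smoothing a eta (mW n) tau0.
have tau2 : tau ^+ 2 = eta ^+ 4 by rewrite -exprM.
have etau : eta / tau = eta^-1 by rewrite /tau; field; rewrite gt_eqF.
have := smooth n (a + eta) tau n0 tau0 Kn.
have := smooth n (a - eta) tau n0 tau0 Kn.
rewrite tau2 !ler_norml => /andP[B1 B2] /andP[B3 B4].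
have : `|ncdf (a / s) - ncdf ((a + 1 * eta) / Num.sqrt (eta ^+ 4 + v n))| <= e / 2.
  near: n; apply: lim_pm; near: eta.
  by have := @ncdf_shift_cvg a s 1 s0 => /cvgrPdist_le; exact.
have : `|ncdf (a / s) - ncdf ((a + -1 * eta) / Num.sqrt (eta ^+ 4 + v n))| <= e / 2.
  near: n; apply: lim_pm; near: eta.
  by have := @ncdf_shift_cvg a s (-1) s0 => /cvgrPdist_le; exact.
rewrite mul1r mulN1r !ler_norml => /andP[C1 C2] /andP[C3 C4].
rewrite mulNr etau in lo; rewrite etau in hi.
have D1 := ncdf_nondecreasing etaM.
have D2 : ncdf (- eta^-1) <= ncdf (- M) by rewrite ncdf_nondecreasing// lerN2.
rewrite -/(p n) in lo hi.
move: lo hi B1 B2 B3 B4 C1 C2 C3 C4 D1 D2 HM HM' err.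
set x1 := Rintegral _ _ _; set x2 := Rintegral _ _ _.
set y1 := ncdf (_ / Num.sqrt _); set y2 := ncdf (_ / Num.sqrt _).
set z1 := ncdf (- eta^-1); set z2 := ncdf (- M); set z3 := ncdf M; set z4 := ncdf eta^-1.
set u := ncdf (a / s); set er := _ / Num.sqrt _; move: (p n) => pn.
clearbody x1 x2 y1 y2 z1 z2 z3 z4 u er.
exact: squeeze_arith.
Unshelve. all: by end_near.
Qed.

End clt.

(** * Densities and convolution *)

Section density.
Context d (T : measurableType d) (R : realType) (P : probability T R).
Local Notation leb := (@lebesgue_measure R).

(** The law of [X] is absolutely continuous with respect to Lebesgue measure, and its Radon-Nikodym
    derivative has the same integrals as [f] over measurable sets, hence equals [f] almost
    everywhere. *)
Lemma density_integral (X : {RV P >-> R}) (f phi : R -> R) (K : R) :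
  has_density X f -> measurable_fun setT phi -> (forall u, `|phi u| <= K) ->
  (\int[P]_w (phi (X w))%:E = \int[leb]_u (phi u * f u)%:E)%E.
Proof.
move=> [fpdf fX] mphi phiK; have [mf f0 f1] := fpdf.
pose X0 : T -> measurableTypeR R := X.
have mX0 : measurable_fun setT X0 by have := measurable_funPT X; exact.
pose XM := isMeasurableFun.Build _ _ _ _ _ mX0.
pose X' : {mfun T >-> measurableTypeR R} := HB.pack X0 XM.
pose nu : probability (measurableTypeR R) R := distribution P X'.
have nuf A : measurable A -> nu A = (\int[leb]_(u in A) (f u)%:E)%E by exact: fX.
have ac : nu `<< leb.
  apply/null_content_dominatesP => A mA A0; rewrite nuf//.
  by apply: null_set_integral => //; apply: measurable_funTS; exact/measurable_EFinP.
have RN : ae_eq leb setT (Radon_Nikodym (charge_of_finite_measure nu) leb) (EFin \o f).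
  apply: integral_ae_eq => //.
  - exact: Radon_Nikodym_integrable.
  - exact/measurable_EFinP.
  - by move=> A _ mA; rewrite -Radon_Nikodym_integral//; exact: nuf.
transitivity (\int[nu]_u (phi u)%:E)%E.
  rewrite integral_distribution//; first exact/measurable_EFinP.
  apply: (@bounded_integrable _ _ _ _ (phi \o X) K); last by move=> w /=.
  exact: measurableT_comp.
rewrite -(Radon_Nikodym_change_of_variables ac)//; last first.
  exact: (@bounded_integrable _ _ _ nu phi K).
apply: ae_eq_integral => //.
- apply: emeasurable_funM; first exact/measurable_EFinP.
  by apply: (measurable_int leb); exact: Radon_Nikodym_integrable.
- by apply/measurable_EFinP; exact: measurable_funM.
- by move: RN; apply: filterS => u /= RNu _; rewrite EFinM RNu.
Qed.

(** Lebesgue measure and its image under translation agree on half-open intervals, hence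
    everywhere. *)
Lemma integral_translate (y : R) (F : R -> \bar R) :
  measurable_fun setT F -> (forall u, 0 <= F u)%E ->
  (\int[leb]_z F z = \int[leb]_u F (u - y)%R)%E.
Proof.
move=> mF F0.
pose t0 : measurableTypeR R -> measurableTypeR R := fun u => u - y.
have mt0 : measurable_fun setT t0 by exact: measurable_funB.
pose tM := isMeasurableFun.Build _ _ _ _ _ mt0.
pose t : {mfun measurableTypeR R >-> measurableTypeR R} := HB.pack t0 tM.
have tE A : measurable A -> leb A = pushforward leb t A.
  apply: lebesgue_measure_unique => //= _ [[a b]] _ <-; rewrite /pushforward.
  have -> : t0 @^-1` `]a, b] = `](a + y), (b + y)]%classic.
    by apply/seteqP; split => u /=; rewrite !in_itv/= ltrBrDr lerBlDr.
  rewrite !lebesgue_measure_itv/= !lte_fin ltrD2r.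
  by case: ifP => // _; rewrite -!EFinD; congr EFin; ring.
transitivity (\int[pushforward leb t]_z F z)%E.
  by apply: eq_measure_integral => /= A mA _; exact: tE.
by rewrite ge0_integral_pushforward.
Qed.

Section sum_density.
Variables (X Y Z : {RV P >-> R}) (k f : R -> R).
Hypotheses (XE : forall w, X w = Y w + Z w) (YZ : independent2 Y Z).
Hypotheses (Yf : has_density Y f) (Zk : has_density Z k).

(** The convolution before [fine] is applied: the extended-real form suits Tonelli, and finiteness
    is established later, almost everywhere. *)
Let I (u : R) : \bar R := (\int[leb]_y (k (u - y) * f y)%:E)%E.

Let mkf : measurable_fun setT (fun z : measurableTypeR R * measurableTypeR R =>
  (k (z.1 - z.2) * f z.2)%:E).
Proof.
have [[mf _ _] _] := Yf; have [[mk _ _] _] := Zk.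
apply/measurable_EFinP; apply: measurable_funM.
  by apply: measurableT_comp => //; exact: measurable_funB.
exact: measurableT_comp.
Qed.

Let mI : measurable_fun setT I.
Proof.
have [[mf f0 f1] _] := Yf; have [[mk k0 k1] _] := Zk.
apply: (@measurable_fun_fubini_tonelli_F _ _ _ _ R leb _ mkf).
by move=> z; rewrite lee_fin mulr_ge0.
Qed.

(** Condition on [Y], insert the density of [Z], translate by [y], insert the density of [Y], and
    exchange the two Lebesgue integrals. *)
Let sum_density_integral0 (phi : R -> R) (K : R) :
  measurable_fun setT phi -> (forall u, 0 <= phi u <= K) ->
  (\int[P]_w (phi (X w))%:E = \int[leb]_u ((phi u)%:E * I u))%E.
Proof.
move=> mphi phiK.
have [[mf f0 f1] _] := Yf; have [[mk k0 k1] _] := Zk.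
have phi0 u : 0 <= phi u by case/andP: (phiK u).
have phiK' u : `|phi u| <= K by rewrite ger0_norm//; case/andP: (phiK u).
pose F (z : R * R) := phi (z.1 + z.2).
pose G y := \int[P]_w' F (y, Z w').
have mF : measurable_fun setT F.
  by apply: measurableT_comp => //; exact: measurable_funD.
have mY : measurable_fun setT Y := measurable_funPT Y.
have mZ : measurable_fun setT Z := measurable_funPT Z.
have mX : measurable_fun setT X := measurable_funPT X.
have mFy (y : R) : measurable_fun setT (fun z => phi (y + z)).
  by apply: measurableT_comp => //; exact: measurable_funD.
have mFZ y : measurable_fun setT (fun w' => F (y, Z w')).
  exact: (measurableT_comp (mFy y) mZ).
have GE y : ((G y)%:E = \int[P]_w' (phi (y + Z w'))%:E)%E.
  rewrite /G /Rintegral fineK//.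
  exact: (integrable_fin_num _ (bounded_integrable P (mFZ y) (fun w => phiK' _))).
have GK y : `|G y| <= K by apply: normr_Rintegral_le => // w'; exact: phiK'.
have mG : measurable_fun setT G.
  have : measurable_fun setT (fun y : measurableTypeR R => \int[P]_w' (phi (y + Z w'))%:E)%E.
    apply: (@measurable_fun_fubini_tonelli_F _ _ (measurableTypeR R) T R P
      (fun z : measurableTypeR R * T => (phi (z.1 + Z z.2))%:E)).
      apply/measurable_EFinP; apply: measurableT_comp => //.
      by apply: measurable_funD => //; exact: measurableT_comp.
    by move=> z; rewrite lee_fin.
  by under eq_fun do rewrite -GE; move=> /measurable_EFinP.
have iX : P.-integrable setT (EFin \o fun w => F (Y w, Z w)).
  apply: (@bounded_integrable _ _ _ _ _ K); last by move=> w; exact: phiK'.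
  by apply: measurableT_comp => //; exact: measurable_fun_pair.
have iG : P.-integrable setT (EFin \o fun w => G (Y w)).
  apply: (@bounded_integrable _ _ _ _ _ K); last by move=> w; exact: GK.
  exact: measurableT_comp.
transitivity (\int[P]_w (G (Y w))%:E)%E.
  have [_ FG] := indep_expectation mY mZ YZ mF (fun z => phiK' _).
  rewrite -[RHS]fineK; last exact: (integrable_fin_num _ iG).
  under eq_integral do rewrite XE.
  rewrite -[LHS]fineK; last exact: (integrable_fin_num _ iX).
  by congr EFin; exact: FG.
rewrite (density_integral Yf mG GK).
transitivity (\int[leb]_y \int[leb]_u (phi u * (k (u - y) * f y))%:E)%E.
  apply: eq_integral => y _.
  rewrite EFinM GE (density_integral Zk (mFy y) (fun z => phiK' _)).
  rewrite (integral_translate y); last 2 first.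
  - by apply/measurable_EFinP; exact: measurable_funM.
  - by move=> z; rewrite lee_fin mulr_ge0.
  rewrite -ge0_integralZr//; last first.
  - by rewrite lee_fin.
  - by move=> u _; rewrite lee_fin mulr_ge0.
  - apply/measurable_EFinP; apply: measurable_funM => //.
      by apply: measurableT_comp => //; apply: measurable_funD => //; exact: measurable_funB.
    by apply: measurableT_comp => //; exact: measurable_funB.
  by apply: eq_integral => u _; rewrite -EFinM -mulrA addrCA subrr addr0.
rewrite -(@fubini_tonelli _ _ _ _ R leb leb
  (fun z : measurableTypeR R * measurableTypeR R =>
    (phi z.1 * (k (z.1 - z.2) * f z.2))%:E))/=; last 2 first.
- under eq_fun do rewrite EFinM; apply: emeasurable_funM; last exact: mkf.
  by apply/measurable_EFinP; exact: measurableT_comp.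
- by move=> z; rewrite lee_fin !mulr_ge0.
apply: eq_integral => u _; rewrite /I -ge0_integralZl//=.
- apply/measurable_EFinP; apply: measurable_funM => //.
  by apply: measurableT_comp => //; exact: measurable_funB.
- by move=> y _; rewrite lee_fin mulr_ge0.
- by rewrite lee_fin.
Qed.

(** The case [phi = 1] of [sum_density_integral0] shows that [I] has integral 1. It is therefore
    finite almost everywhere, and there equals [convolution k f]. *)
Lemma sum_density_integral (phi : R -> R) (K : R) :
  measurable_fun setT phi -> (forall u, 0 <= phi u <= K) ->
  \int[P]_w phi (X w) = \int[leb]_u (phi u * convolution k f u).
Proof.
move=> mphi phiK; rewrite /Rintegral; congr fine.
have [[mf f0 f1] _] := Yf; have [[mk k0 k1] _] := Zk.
have I0 u : (0 <= I u)%E by apply: integral_ge0 => y _; rewrite lee_fin mulr_ge0.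
rewrite (sum_density_integral0 mphi phiK).
have intI : leb.-integrable setT I.
  apply/integrableP; split => //.
  under eq_integral do rewrite gee0_abs//.
  have -> : (\int[leb]_u I u = \int[leb]_u ((cst 1 u : R)%:E * I u))%E.
    by apply: eq_integral => u _; rewrite mul1e.
  rewrite -(@sum_density_integral0 (cst 1) 1 (measurable_cst _)) => [|u]; last by rewrite ler01/=.
  by rewrite (integral_cst P measurableT 1%:E) [X in (_ * X)%E]probability_setT mule1 ltry.
have mconv : measurable_fun setT (convolution k f).
  by apply: measurableT_comp => //.
apply: ae_eq_integral => //.
- by apply: emeasurable_funM => //; exact/measurable_EFinP.
- by apply/measurable_EFinP; exact: measurable_funM.
have := integrable_ae measurableT intI.
apply: filterS => u /= + _ => /(_ Logic.I) Iu; rewrite EFinM; congr *%E.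
by rewrite /convolution /Rintegral fineK.
Qed.

End sum_density.

End density.

(** * Moments of damped cosines *)

Section moments.
Context d (T : measurableType d) (R : realType) (P : probability T R).
Local Notation leb := (@lebesgue_measure R).

Lemma measurable_cos : measurable_fun setT (@cos R).
Proof. by apply: continuous_measurable_fun; exact: continuous_cos. Qed.

Lemma measurable_sin : measurable_fun setT (@sin R).
Proof. by apply: continuous_measurable_fun; exact: continuous_sin. Qed.

Lemma normr_cos_le1 (t : R) : `|cos t| <= 1.
Proof. by rewrite ler_norml cos_geN1 cos_le1. Qed.

Lemma normr_sin_le1 (t : R) : `|sin t| <= 1.
Proof. by rewrite ler_norml sin_geN1 sin_le1. Qed.

Lemma fourierE (k : R -> R) (t : R) : fourier k t =
  (\int[leb]_u (cos (t * u) * k u)) +i* (\int[leb]_u (sin (t * u) * k u)).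
Proof.
rewrite /fourier /cintegral; congr (_ +i* _); apply: eq_Rintegral => u _ /=.
  by rewrite mulr0 subr0.
by rewrite mulr0 add0r.
Qed.

(** Since the transform of [k] at [t] is real, [sin (t * Z)] has mean 0; averaging over [Z] with [Y]
    frozen leaves [cos (t * (Y - x)) * c]. *)
Lemma cos_mean_bound (X Y Z : {RV P >-> R}) (k : R -> R) (x t c : R) :
  (forall w, X w = Y w + Z w) -> independent2 Y Z -> has_density Z k ->
  fourier k t = c%:C -> `|\int[P]_w cos (t * (X w - x))| <= `|c|.
Proof.
move=> XE YZ Zk; rewrite fourierE => -[cosk sink].
have mY : measurable_fun setT Y := measurable_funPT Y.
have mZ : measurable_fun setT Z := measurable_funPT Z.
have mt (g : R -> R) : measurable_fun setT g -> measurable_fun setT (fun u => g (t * u)).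
  by move=> mg; apply: measurableT_comp => //; exact: measurable_funM.
have mcosZ : measurable_fun setT (fun w => cos (t * Z w)).
  exact: (measurableT_comp (mt _ measurable_cos)).
have msinZ : measurable_fun setT (fun w => sin (t * Z w)).
  exact: (measurableT_comp (mt _ measurable_sin)).
have EcosZ : \int[P]_w cos (t * Z w) = c.
  rewrite -cosk /Rintegral; congr fine.
  exact: (density_integral Zk (mt _ measurable_cos) (fun u => normr_cos_le1 _)).
have EsinZ : \int[P]_w sin (t * Z w) = 0.
  rewrite -sink /Rintegral; congr fine.
  exact: (density_integral Zk (mt _ measurable_sin) (fun u => normr_sin_le1 _)).
pose F (z : R * R) := cos (t * (z.1 + z.2 - x)).
have mF : measurable_fun setT F.
  apply: (measurableT_comp (mt _ measurable_cos)).
  by apply: measurable_funB => //; exact: measurable_funD.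
have [mI E] := indep_expectation mY mZ YZ mF (fun z => normr_cos_le1 _).
under eq_Rintegral do rewrite XE.
rewrite -[X in `|X|]/(\int[P]_w F (Y w, Z w)) E.
apply: normr_Rintegral_le => // w.
have -> : \int[P]_w' F (Y w, Z w') = cos (t * (Y w - x)) * c.
  transitivity (\int[P]_w' (cos (t * (Y w - x)) * cos (t * Z w') -
      sin (t * (Y w - x)) * sin (t * Z w'))).
    by apply: eq_Rintegral => w' _; rewrite -cosD /F /=; congr cos; ring.
  have icos : P.-integrable setT (EFin \o fun w => cos (t * Z w)).
    exact: (bounded_integrable P mcosZ (fun w => normr_cos_le1 _)).
  have isin : P.-integrable setT (EFin \o fun w => sin (t * Z w)).
    exact: (bounded_integrable P msinZ (fun w => normr_sin_le1 _)).
  rewrite RintegralB//.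
  - by rewrite !RintegralZl// EcosZ EsinZ mulr0 subr0.
  - exact: (integrableZl measurableT _ icos).
  - exact: (integrableZl measurableT _ isin).
by rewrite normrM ler_piMl// normr_cos_le1.
Qed.

(** After exchanging the expectation with the integral over [[0, L]], the decay [expR (- (a * r))]
    of the mean cosine cancels the growth [expR (a * r)], so only [|p r| <= K] remains. *)
Lemma fubini_cos_bound (X : {RV P >-> R}) (x a L K : R) (p J : R -> R) :
  0 <= a -> 0 <= L ->
  (forall t, 0 <= t -> `|\int[P]_w cos (t * (X w - x))| <= expR (- (a * t))) ->
  measurable_fun setT p -> (forall r, 0 <= r <= L -> `|p r| <= K) ->
  (forall b : R,
    (\int[leb]_(r in `[0%R, L]) (p r * (expR (a * r) * cos (b * r)))%:E = (J b)%:E)%E) ->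
  `|\int[P]_w J (X w - x)| <= K * L.
Proof.
move=> a0 L0 cosX mp pK JE.
have mX : measurable_fun setT X := measurable_funPT X.
have K0 : 0 <= K by apply: le_trans (pK 0 _); rewrite ?lexx.
pose D : set (measurableTypeR R) := `[0, L]%classic.
have mD : measurable D by exact: measurable_itv.
pose q r := \1_D r * (p r * expR (a * r)).
have mq : measurable_fun setT q.
  apply: measurable_funM; first exact: measurable_indic.
  apply: measurable_funM => //; apply: measurableT_comp => //; exact: measurable_funM.
have qK r : `|q r| <= K * expR (a * L) * \1_D r.
  rewrite /q indicE; have [rD|rD] := boolP (r \in D); last by rewrite mul0r normr0 mulr0.
  move: rD; rewrite inE /D/= in_itv/= => rL.
  rewrite mul1r mulr1 normrM (ger0_norm (expR_ge0 _)) ler_pM ?expR_ge0 ?pK//.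
  by rewrite ler_expR ler_wpM2l//; case/andP: rL.
pose psi (z : T * measurableTypeR R) : \bar R := (q z.2 * cos (z.2 * (X z.1 - x)))%:E.
have mpsi : measurable_fun setT psi.
  apply/measurable_EFinP; apply: measurable_funM; first exact: measurableT_comp.
  apply: (measurableT_comp measurable_cos); apply: measurable_funM => //.
  by apply: measurable_funB => //; exact: measurableT_comp.
have mpsiw w : measurable_fun setT (fun r : measurableTypeR R => psi (w, r)).
  apply/measurable_EFinP; apply: measurable_funM => //.
  apply: (measurableT_comp measurable_cos).
  by rewrite /=; apply: measurable_funM; [exact: measurable_id|exact: measurable_cst].
have lebD : leb D = L%:E.
  rewrite /D lebesgue_measure_itv/= lte_fin.
  move: L0; rewrite le_eqVlt => /predU1P[<-|->]; first by rewrite ltxx.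
  by rewrite oppr0 adde0.
have int_indic (c : R) : 0 <= c -> (\int[leb]_r (c * \1_D r)%:E = (c * L)%:E)%E.
  move=> c0; under eq_integral do rewrite EFinM.
  rewrite ge0_integralZl//=; last by apply/measurable_EFinP; exact: measurable_indic.
  by rewrite integral_indic// setIT EFinM; congr *%E; exact: lebD.
have ipsi : (P \x leb)%E.-integrable setT psi.
  apply/integrable12ltyP => //.
  apply: (@le_lt_trans _ _ (\int[P]_w (K * expR (a * L) * L)%:E)%E); last first.
    by rewrite (integral_cst P measurableT) [X in (_ * X)%E]probability_setT mule1 ltry.
  apply: ge0_le_integral => //.
  - by move=> w _; exact: integral_ge0.
  - apply: (@measurable_fun_fubini_tonelli_F _ _ _ _ R leb (abse \o psi)).
      exact: measurableT_comp.
    by move=> z; exact: abse_ge0.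
  - move=> w _; rewrite -int_indic; last by rewrite mulr_ge0 ?expR_ge0.
    apply: ge0_le_integral => //.
    + by apply: measurableT_comp => //; exact: mpsiw.
    + by apply/measurable_EFinP; apply: measurable_funM => //; exact: measurable_indic.
    + move=> r _; rewrite /psi abse_EFin lee_fin normrM.
      by rewrite (le_trans _ (qK r))// ler_piMr// normr_cos_le1.
have JpsiE w : ((J (X w - x))%:E = \int[leb]_r psi (w, r))%E.
  rewrite -JE integral_mkcond; apply: eq_integral => r _.
  rewrite patchE /psi /q indicE /D/= (mulrC r); case: ifPn => rD; last by rewrite !mul0r.
  by rewrite mul1r -mulrA.
have EJ : (\int[P]_w (J (X w - x))%:E = \int[leb]_r \int[P]_w psi (w, r))%E.
  rewrite -(Fubini ipsi); apply: eq_integral => w _; exact: JpsiE.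
have bound : (`|\int[P]_w (J (X w - x))%:E| <= (K * L)%:E)%E.
  rewrite EJ -(int_indic K K0).
  apply: le_trans (le_abse_integral _ measurableT _) _.
    exact: (measurable_fubini_G ipsi).
  apply: ge0_le_integral => //.
  - apply: measurableT_comp => //; exact: (measurable_fubini_G ipsi).
  - by apply/measurable_EFinP; apply: measurable_funM => //; exact: measurable_indic.
  - move=> r _; rewrite /psi /=.
    have mc : measurable_fun setT (fun w => cos (r * (X w - x))).
      apply: (measurableT_comp measurable_cos); apply: measurable_funM => //.
      exact: measurable_funB.
    have ic := bounded_integrable P mc (fun w => normr_cos_le1 _).
    under eq_integral do rewrite EFinM.
    rewrite integralZl// abseM -EFin_normr_Rintegral// abse_EFin -EFinM lee_fin.
    rewrite /q indicE; have [rD|rD] := boolP (r \in D); last by rewrite mul0r normr0 mul0r mulr0.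
    move: rD; rewrite inE /D/= in_itv/= => /andP[r0 rL].
    rewrite mul1r mulr1 normrM (ger0_norm (expR_ge0 _)) -mulrA.
    rewrite -[leRHS]mulr1 ler_pM ?pK ?r0// ?mulr_ge0 ?expR_ge0//.
    by rewrite -(expRxMexpNx_1 (a * r)) ler_wpM2l ?expR_ge0// cosX.
by move: bound; rewrite /Rintegral; case: (integral _ _ _) => [r| |].
Qed.

End moments.

(** * Closed forms and bounds for damped cosine integrals *)

Section damped_cosine.
Context (R : realType).
Local Notation leb := (@lebesgue_measure R).
Implicit Types (a b L r : R).

Lemma continuous_FTC2_global (f F : R -> R) a b : a < b ->
  (forall x, is_derive x (1 : R) F (f x)) -> continuous f ->
  (\int[leb]_(x in `[a, b]) (f x)%:E = (F b - F a)%:E)%E.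
Proof.
move=> ab dF cf; rewrite EFinB; have cF : continuous F.
  by move=> t; apply: differentiable_continuous; exact/derivable1_diffP.
apply: continuous_FTC2 => //.
- exact: continuous_subspaceT.
- split=> [x _|/=|/=]; first exact: ex_derive.
    by apply: cvg_at_right_filter; exact: cF.
  by apply: cvg_at_left_filter; exact: cF.
- by move=> x _; rewrite derive1E derive_val.
Qed.

Lemma continuous_expcos a b : continuous (fun r => expR (a * r) * cos (b * r)).
Proof.
move=> r; apply: differentiable_continuous; apply/derivable1_diffP; exact: ex_derive.
Qed.

(** The real part of [(e^((a+ib)L) - 1) / (a+ib)], that is, the integral of
    [expR (a * r) * cos (b * r)] over [[0, L]]. *)
Definition dcos1 a L b : R :=
  (expR (a * L) * (a * cos (b * L) + b * sin (b * L)) - a) / (a ^+ 2 + b ^+ 2).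

(* The integral of [(L - r) e^(ar) cos(br)] over [[0, L]]: the weight [L - r] makes
   [Re (e^((a+ib)L) / (a+ib)^2)] appear. *)
Definition dcos2 a L b : R :=
  expR (a * L) * ((a ^+ 2 - b ^+ 2) * cos (b * L) + 2 * a * b * sin (b * L)) /
    (a ^+ 2 + b ^+ 2) ^+ 2 -
  (L * a / (a ^+ 2 + b ^+ 2) + (a ^+ 2 - b ^+ 2) / (a ^+ 2 + b ^+ 2) ^+ 2).

Lemma sum_sqr_gt0 a b : 0 < a -> 0 < a ^+ 2 + b ^+ 2.
Proof. by move=> a0; rewrite ltr_wpDr ?sqr_ge0 ?exprn_gt0. Qed.

(** Both signs of [a] and general endpoints are covered because [gsinc_integral] uses [- a] on the
    negative half-line. *)
Lemma integral_expcos a b L1 L2 : a != 0 -> L1 < L2 ->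
  let F r := expR (a * r) * (a * cos (b * r) + b * sin (b * r)) / (a ^+ 2 + b ^+ 2) in
  (\int[leb]_(r in `[L1, L2]) (expR (a * r) * cos (b * r))%:E = (F L2 - F L1)%:E)%E.
Proof.
move=> a0 L12 F.
have D0 : a ^+ 2 + b ^+ 2 != 0 by rewrite gt_eqF// ltr_wpDr ?sqr_ge0// exprn_even_gt0.
have dF r : is_derive r (1 : R) F (expR (a * r) * cos (b * r)).
  by rewrite /F; apply: is_derive_eq; rewrite /GRing.scale/=; field.
by rewrite (continuous_FTC2_global L12 dF)//; exact: continuous_expcos.
Qed.

Lemma dcos1E a L b : 0 < a -> 0 < L ->
  (\int[leb]_(r in `[0%R, L]) (expR (a * r) * cos (b * r))%:E = (dcos1 a L b)%:E)%E.
Proof.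
move=> a0 L0; have D0 := sum_sqr_gt0 b a0.
rewrite integral_expcos ?gt_eqF//.
by congr EFin; rewrite /dcos1 !mulr0 expR0 cos0 sin0; field; rewrite gt_eqF.
Qed.

Lemma dcos2E a L b : 0 < a -> 0 < L ->
  (\int[leb]_(r in `[0%R, L]) ((L - r) * (expR (a * r) * cos (b * r)))%:E = (dcos2 a L b)%:E)%E.
Proof.
move=> a0 L0; have D0 := sum_sqr_gt0 b a0.
(* The antiderivative comes from integration by parts: it is the real part of [(L - r) e^((a+ib)r) /
   (a+ib) + e^((a+ib)r) / (a+ib)^2]. *)
pose F r := expR (a * r) * ((L - r) * (a * cos (b * r) + b * sin (b * r)) / (a ^+ 2 + b ^+ 2)
  + ((a ^+ 2 - b ^+ 2) * cos (b * r) + 2 * a * b * sin (b * r)) / (a ^+ 2 + b ^+ 2) ^+ 2).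
have dF r : is_derive r (1 : R) F ((L - r) * (expR (a * r) * cos (b * r))).
  by rewrite /F; apply: is_derive_eq; rewrite /GRing.scale/=; field; rewrite gt_eqF.
rewrite (continuous_FTC2_global L0 dF); last first.
  move=> r; apply: cvgM; last exact: continuous_expcos.
  by apply: cvgB; [exact: cvg_cst|exact: cvg_id].
by congr EFin; rewrite /F /dcos2 !mulr0 expR0 cos0 sin0; field; rewrite gt_eqF.
Qed.

Lemma measurable_invD a : 0 < a -> measurable_fun setT (fun b : R => (a ^+ 2 + b ^+ 2)^-1).
Proof.
move=> a0; apply: continuous_measurable_fun => b.
apply: cvgV; first by rewrite gt_eqF// sum_sqr_gt0.
by apply: cvgD; [exact: cvg_cst|exact: exprn_continuous].
Qed.

Lemma measurable_inv2D a : 0 < a ->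
  measurable_fun setT (fun b : R => (2 * (a ^+ 2 + b ^+ 2))^-1).
Proof.
move=> a0; under eq_fun do rewrite invfM.
by apply: measurable_funM => //; exact: measurable_invD.
Qed.

Lemma normr_inv2D_le a b : 0 < a -> `|(2 * (a ^+ 2 + b ^+ 2))^-1| <= (a ^+ 2)^-1.
Proof.
move=> a0; have D0 := sum_sqr_gt0 b a0.
rewrite normfV gtr0_norm ?mulr_gt0// lef_pV2 ?posrE ?mulr_gt0 ?exprn_gt0//.
by have := sqr_ge0 b; have := sqr_ge0 a; lra.
Qed.

Definition xi a L b : R := expR (- (a * L)) * dcos1 a L b.

Lemma xiE a L b : xi a L b =
  (a * cos (b * L) + b * sin (b * L) - a * expR (- (a * L))) / (a ^+ 2 + b ^+ 2).
Proof.
have e1 := expRxMexpNx_1 (a * L).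
rewrite /xi /dcos1; set D := (_ + _)^-1.
transitivity ((expR (a * L) * expR (- (a * L))) * (a * cos (b * L) + b * sin (b * L)) * D -
  a * expR (- (a * L)) * D); first by ring.
by rewrite e1; ring.
Qed.

Lemma normr_xi_le a L b : 0 < a -> 0 <= L -> `|xi a L b| <= 3 / a.
Proof.
move=> a0 L0; rewrite xiE; have D0 := sum_sqr_gt0 b a0.
rewrite normrM normfV (gtr0_norm D0) ler_pdivrMr// mulrAC ler_pdivlMr//.
have c1 := normr_cos_le1 (b * L); have s1 := normr_sin_le1 (b * L).
have e0 := expR_ge0 (- (a * L)).
have e1 : expR (- (a * L)) <= 1 by rewrite expR_le1 oppr_le0 mulr_ge0// ltW.
have num : `|a * cos (b * L) + b * sin (b * L) - a * expR (- (a * L))| <= a + `|b| + a.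
  apply: le_trans (ler_normB _ _) _; apply: lerD.
    apply: le_trans (ler_normD _ _) _; rewrite !normrM (gtr0_norm a0).
    by rewrite lerD// -[leRHS]mulr1 ler_pM// ltW.
  by rewrite normrM (gtr0_norm a0) (ger0_norm e0) -[leRHS]mulr1 ler_pM// ltW.
apply: (@le_trans _ _ ((a + `|b| + a) * a)); first by rewrite ler_pM// ltW.
by have := real_normK (num_real b); have := sqr_ge0 (a - `|b|); nra.
Qed.

(* [Re (e^(ibL) / (a+ib)^2)], which enters [xi a L ^+ 2] as [osc a (2 * L) b / 2] *)
Definition osc a L b : R :=
  ((a ^+ 2 - b ^+ 2) * cos (b * L) + 2 * a * b * sin (b * L)) / (a ^+ 2 + b ^+ 2) ^+ 2.

Lemma osc_dcos2 a L b : 0 < a ->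
  osc a L b = expR (- (a * L)) * (dcos2 a L b +
    (L * a / (a ^+ 2 + b ^+ 2) + (a ^+ 2 - b ^+ 2) / (a ^+ 2 + b ^+ 2) ^+ 2)).
Proof.
move=> a0; have e1 := expRxMexpNx_1 (a * L).
by rewrite /dcos2 subrK -mulrA mulrA (mulrC (expR _)) e1 mul1r.
Qed.

(** Up to its term in [expR (- (a * L))], [xi a L b] is the real part of [z = e^(ibL) / (a+ib)], and
    [(Re z)^2 = |z|^2 / 2 + Re (z^2) / 2]. Everything left over carries the factor
    [expR (- (a * L))]. *)
Lemma xi_sqr a L b : 0 < a -> 0 <= L ->
  `|xi a L b ^+ 2 - (2 * (a ^+ 2 + b ^+ 2))^-1 - osc a (2 * L) b / 2| <=
    5 / a ^+ 2 * expR (- (a * L)).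
Proof.
move=> a0 L0; have D0 := sum_sqr_gt0 b a0; set D := a ^+ 2 + b ^+ 2 in D0 *.
have c1 := normr_cos_le1 (b * L); have s1 := normr_sin_le1 (b * L).
have e0 := expR_ge0 (- (a * L)).
have e1 : expR (- (a * L)) <= 1 by rewrite expR_le1 oppr_le0 mulr_ge0// ltW.
set C := cos (b * L) in c1 *; set S := sin (b * L) in s1 *; set e := expR _ in e0 e1 *.
have cs : C ^+ 2 + S ^+ 2 = 1 by exact: cos2Dsin2.
have c2 : cos (b * (2 * L)) = 2 * C ^+ 2 - 1.
  by rewrite (_ : b * (2 * L) = (b * L) *+ 2) ?cos_mulr2n; [rewrite /C; ring|ring].
have s2 : sin (b * (2 * L)) = 2 * S * C.
  by rewrite (_ : b * (2 * L) = (b * L) *+ 2) ?sin_mulr2n; [rewrite /C /S; ring|ring].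
rewrite xiE /osc c2 s2 -/D -/C -/S -/e.
have -> : ((a * C + b * S - a * e) / D) ^+ 2 - (2 * D)^-1 -
    ((a ^+ 2 - b ^+ 2) * (2 * C ^+ 2 - 1) + 2 * a * b * (2 * S * C)) / D ^+ 2 / 2 =
    e * (a ^+ 2 * e - 2 * a * (a * C + b * S)) / D ^+ 2.
  have S2 : S ^+ 2 = 1 - C ^+ 2 by rewrite -cs; ring.
  (* The added terms are zero, the first by [S2]. Written out, they make the identity hold with [C]
     and [S] as independent variables, within reach of [field]. *)
  transitivity ((e * (a ^+ 2 * e - 2 * a * (a * C + b * S)) + b ^+ 2 * (S ^+ 2 - (1 - C ^+ 2))
    + ((a ^+ 2 + b ^+ 2) - D) / 2) / D ^+ 2).
    by rewrite /D; field; rewrite -/D gt_eqF.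
  by rewrite S2 subrr mulr0 subrr mul0r !addr0.
have numb : `|a ^+ 2 * e - 2 * a * (a * C + b * S)| <= 5 * D.
  apply: (@le_trans _ _ (a ^+ 2 + 2 * a * (a + `|b|))).
    apply: le_trans (ler_normB _ _) _; apply: lerD.
      rewrite normrM (ger0_norm e0) ger0_norm ?sqr_ge0//.
      by rewrite ler_piMr// sqr_ge0.
    have a20 : 0 <= 2 * a by rewrite mulr_ge0// ltW.
    rewrite normrM (ger0_norm a20) ler_wpM2l//.
    apply: le_trans (ler_normD _ _) _; rewrite !normrM (gtr0_norm a0).
    by rewrite lerD// ler_piMr// ltW.
  by have := real_normK (num_real b); have := sqr_ge0 (a - `|b|); rewrite /D; nra.
rewrite normrM normfV (gtr0_norm (exprn_gt0 2 D0)) normrM (ger0_norm e0).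
have aD : a ^+ 2 <= D by rewrite /D lerDl sqr_ge0.
rewrite -mulrA [leLHS]mulrC; apply: ler_wpM2r => //.
rewrite ler_pdivrMr ?exprn_gt0// (le_trans numb)//.
rewrite (_ : 5 / a ^+ 2 * D ^+ 2 = 5 * (D * (D / a ^+ 2))); last by ring.
rewrite ler_wpM2l//; apply: ler_peMr; first exact: ltW.
by rewrite ler_pdivlMr ?exprn_gt0// mul1r.
Qed.

Lemma measurable_trigM (g : R -> R) L : measurable_fun setT g ->
  measurable_fun setT (fun b => g (b * L)).
Proof. by move=> mg; apply: measurableT_comp => //; exact: measurable_funM. Qed.

Lemma measurable_xi a L : 0 < a -> measurable_fun setT (xi a L).
Proof.
move=> a0; rewrite (_ : xi a L = fun b => (a * cos (b * L) + b * sin (b * L) -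
  a * expR (- (a * L))) * (a ^+ 2 + b ^+ 2)^-1); last by apply/funext => b; exact: xiE.
apply: measurable_funM; last exact: measurable_invD.
apply: measurable_funB => //; apply: measurable_funD; apply: measurable_funM => //.
  exact: (measurable_trigM L (@measurable_cos R)).
exact: (measurable_trigM L (@measurable_sin R)).
Qed.

Lemma measurable_osc a L : 0 < a -> measurable_fun setT (osc a L).
Proof.
move=> a0; rewrite (_ : osc a L = fun b => ((a ^+ 2 - b ^+ 2) * cos (b * L) +
  2 * a * b * sin (b * L)) * ((a ^+ 2 + b ^+ 2)^-1) ^+ 2); last first.
  by apply/funext => b; rewrite /osc exprVn.
apply: measurable_funM; last by apply: measurable_funX; exact: measurable_invD.
apply: measurable_funD; apply: measurable_funM => //.
- by apply: measurable_funB => //; exact: measurable_funX.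
- exact: (measurable_trigM L (@measurable_cos R)).
- exact: (measurable_trigM L (@measurable_sin R)).
Qed.

Lemma normr_diff_sqr_le a b : 0 < a -> `|(a ^+ 2 - b ^+ 2) / (a ^+ 2 + b ^+ 2) ^+ 2| <= (a ^+ 2)^-1.
Proof.
move=> a0; have D0 := sum_sqr_gt0 b a0.
rewrite normrM normfV (gtr0_norm (exprn_gt0 2 D0)).
rewrite ler_pdivrMr ?exprn_gt0// mulrC ler_pdivlMr ?exprn_gt0//.
have := sqr_ge0 a; have := sqr_ge0 b => b2 a2.
have : `|a ^+ 2 - b ^+ 2| <= a ^+ 2 + b ^+ 2 by rewrite ler_norml; apply/andP; split; lra.
by have := normr_ge0 (a ^+ 2 - b ^+ 2); nra.
Qed.

Lemma normr_osc_le a L b : 0 < a -> `|osc a L b| <= 2 / a ^+ 2.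
Proof.
move=> a0; have D0 := sum_sqr_gt0 b a0.
have c1 := normr_cos_le1 (b * L); have s1 := normr_sin_le1 (b * L).
rewrite /osc normrM normfV (gtr0_norm (exprn_gt0 2 D0)).
rewrite ler_pdivrMr ?exprn_gt0// [leRHS]mulrAC ler_pdivlMr ?exprn_gt0//.
have num : `|(a ^+ 2 - b ^+ 2) * cos (b * L) + 2 * a * b * sin (b * L)| <= 2 * (a ^+ 2 + b ^+ 2).
  apply: le_trans (ler_normD _ _) _; rewrite [leRHS]mulr_natl [leRHS]mulr2n; apply: lerD.
    rewrite normrM; apply: le_trans (ler_piMr _ c1) _ => //.
    by have := sqr_ge0 a; have := sqr_ge0 b; rewrite ler_norml; lra.
  rewrite normrM; apply: le_trans (ler_piMr _ s1) _ => //.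
  by have := sqr_ge0 (a - b); have := sqr_ge0 (a + b); rewrite ler_norml; nra.
have := sqr_ge0 a; have := sqr_ge0 b => b2 a2.
by have := normr_ge0 ((a ^+ 2 - b ^+ 2) * cos (b * L) + 2 * a * b * sin (b * L)); nra.
Qed.

End damped_cosine.

(** * First and second moments of [xi] *)

Section moments_xi.
Context d (T : measurableType d) (R : realType) (P : probability T R).
Variables (X : {RV P >-> R}) (x a : R).
Hypothesis a0 : 0 < a.
Hypothesis cosX : forall t, 0 <= t -> `|\int[P]_w cos (t * (X w - x))| <= expR (- (a * t)).

(** From [(a L / 3) ^+ 3 <= expR (a L)]. All errors below are at most a multiple of
    [L ^+ 2 * expR (- (a * L))], and this puts them in the common form constant over [L]. *)
Lemma sqrM_expN_le (L : R) : 1 <= L ->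
  L ^+ 2 * expR (- (a * L)) <= (27 / a ^+ 3) / L.
Proof.
move=> L1; have L0 : 0 < L by lra.
have e3 : (a * L / 3) ^+ 3 <= expR (a * L).
  rewrite -[in leRHS](@divfK _ 3 _ (a * L))// expRM_natr lerXn2r ?nnegrE ?expR_ge0//.
    by rewrite divr_ge0 ?mulr_ge0// ltW.
  by apply: le_trans (expR_ge1Dx _); rewrite lerDr.
rewrite expRN ler_pdivlMr// mulrAC -exprSr ler_pdivrMr ?expR_gt0//.
rewrite mulrAC ler_pdivlMr ?exprn_gt0//.
rewrite (_ : L ^+ 3 * a ^+ 3 = 27 * (a * L / 3) ^+ 3); last by field.
by rewrite ler_wpM2l.
Qed.

Let mXx : measurable_fun setT (fun w => X w - x).
Proof. by apply: measurable_funB => //; exact: measurable_funPT. Qed.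

Let ixi L : 0 <= L -> P.-integrable setT (EFin \o fun w => xi a L (X w - x)).
Proof.
move=> L0; apply: (bounded_integrable P _ (fun w => normr_xi_le _ a0 L0)).
exact: (measurableT_comp (measurable_xi L a0)).
Qed.

Let iosc L : P.-integrable setT (EFin \o fun w => osc a L (X w - x)).
Proof.
apply: (bounded_integrable P _ (fun w => normr_osc_le L _ a0)).
exact: (measurableT_comp (measurable_osc L a0)).
Qed.

Lemma mean_xi_le (L : R) : 1 <= L ->
  `|\int[P]_w xi a L (X w - x)| <= (27 / a ^+ 3) / L.
Proof.
move=> L1; have L0 : 0 < L by lra.
have bound : `|\int[P]_w dcos1 a L (X w - x)| <= 1 * L.
  apply: (fubini_cos_bound (ltW a0) (ltW L0) cosX (measurable_cst (1 : R))) => [r _|b].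
    by rewrite normr1.
  by rewrite -dcos1E//; apply: eq_integral => r _; rewrite mul1r.
have dE b : dcos1 a L b = expR (a * L) * xi a L b.
  by rewrite /xi mulrA expRxMexpNx_1 mul1r.
have E : \int[P]_w xi a L (X w - x) = expR (- (a * L)) * \int[P]_w dcos1 a L (X w - x).
  under [in RHS]eq_Rintegral do rewrite dE.
  rewrite RintegralZl//; last exact/ixi/ltW.
  by rewrite mulrA [X in _ = X * _]mulrC expRxMexpNx_1 mul1r.
rewrite E normrM (ger0_norm (expR_ge0 _)).
apply: le_trans (sqrM_expN_le L1); rewrite mulrC ler_wpM2r ?expR_ge0//.
apply: le_trans bound _; rewrite mul1r expr2; apply: ler_peMl => //; exact: ltW.
Qed.

(** By [osc_dcos2], [osc] is [expR (- (a * L))] times [dcos2] plus a boundary term. The weight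
    [L - r] is at most [L] on [[0, L]], so the mean of [dcos2] is at most [L ^+ 2]. *)
Lemma mean_osc_le (L : R) : 1 <= L ->
  `|\int[P]_w osc a L (X w - x)| <= ((1 + a^-1 + (a ^+ 2)^-1) * (27 / a ^+ 3)) / L.
Proof.
move=> L1; have L0 : 0 < L by lra.
(* The contribution of the endpoint [r = 0] to [dcos2], bounded by a linear function of [L]. *)
pose m b := L * a / (a ^+ 2 + b ^+ 2) + (a ^+ 2 - b ^+ 2) / (a ^+ 2 + b ^+ 2) ^+ 2.
have mm : measurable_fun setT m.
  rewrite (_ : m = fun b => L * a * (a ^+ 2 + b ^+ 2)^-1 + osc a 0 b); last first.
    by apply/funext => b; rewrite /m /osc mulr0 cos0 sin0 mulr1 mulr0 addr0.
  apply: measurable_funD; last exact: measurable_osc.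
  by apply: measurable_funM => //; exact: measurable_invD.
have mb b : `|m b| <= L / a + (a ^+ 2)^-1.
  apply: le_trans (ler_normD _ _) _; apply: lerD; last exact: normr_diff_sqr_le.
  have D0 := sum_sqr_gt0 b a0.
  rewrite ger0_norm; last by rewrite divr_ge0 ?mulr_ge0// ltW.
  rewrite ler_pdivrMr// mulrAC ler_pdivlMr// -mulrA ler_pM2l//.
  by rewrite -expr2 lerDl sqr_ge0.
have im : P.-integrable setT (EFin \o fun w => m (X w - x)).
  by apply: (bounded_integrable P _ (fun w => mb _)); exact: (measurableT_comp mm).
have bound : `|\int[P]_w dcos2 a L (X w - x)| <= L * L.
  apply: (@fubini_cos_bound _ _ _ _ X x a L L (fun r => L - r) _ (ltW a0) (ltW L0) cosX).
  - exact: measurable_funB.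
  - by move=> r /andP[r0 rL]; rewrite ger0_norm; lra.
  - by move=> b; exact: dcos2E.
have dE b : dcos2 a L b = expR (a * L) * osc a L b - m b.
  by rewrite (osc_dcos2 L b a0) -/(m b) mulrA expRxMexpNx_1 mul1r addrK.
have e1 := expRxMexpNx_1 (a * L).
have E : \int[P]_w osc a L (X w - x) =
    expR (- (a * L)) * (\int[P]_w dcos2 a L (X w - x) + \int[P]_w m (X w - x)).
  under [in RHS]eq_Rintegral do rewrite dE.
  rewrite RintegralB//; last exact: (integrableZl measurableT _ (iosc L)).
  by rewrite subrK RintegralZl// mulrA [X in _ = X * _]mulrC e1 mul1r.
rewrite E normrM (ger0_norm (expR_ge0 _)).
have mE : `|\int[P]_w m (X w - x)| <= L / a + (a ^+ 2)^-1.
  by apply: normr_Rintegral_le => //; exact: (measurableT_comp mm).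
rewrite -(mulrA (_ + _)); apply: le_trans (ler_wpM2l _ (sqrM_expN_le L1)); last first.
  by rewrite !addr_ge0// invr_ge0 ?sqr_ge0// ltW.
rewrite mulrA mulrC ler_wpM2r ?expR_ge0//.
apply: le_trans (ler_normD _ _) _; apply: le_trans (lerD bound mE) _.
rewrite addrA !mulrDl mul1r -expr2; apply: lerD; last first.
  by rewrite ler_peMr ?invr_ge0 ?sqr_ge0// exprn_ege1.
apply: lerD => //; rewrite mulrC; apply: ler_wpM2l; first by rewrite invr_ge0 ltW.
by rewrite expr2; apply: ler_peMl => //; exact: ltW.
Qed.

(** The expectation of [xi_sqr]: its oscillating term, of frequency [2 * L], is controlled by
    [mean_osc_le], and its error is exponentially small. *)
Lemma mean_xi_sqr_le (L : R) : 1 <= L ->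
  `|\int[P]_w (xi a L (X w - x) ^+ 2) - \int[P]_w (2 * (a ^+ 2 + (X w - x) ^+ 2))^-1| <=
  ((1 + a^-1 + (a ^+ 2)^-1 + 5 / a ^+ 2) * (27 / a ^+ 3)) / L.
Proof.
move=> L1; have L0 : 0 < L by lra.
have i1 : P.-integrable setT (EFin \o fun w => xi a L (X w - x) ^+ 2).
  apply: (@bounded_integrable _ _ _ _ _ ((3 / a) ^+ 2)).
    by apply: measurable_funX; exact: (measurableT_comp (measurable_xi L a0)).
  move=> w; rewrite normrX lerXn2r ?nnegrE// ?normr_xi_le ?ltW//.
  by rewrite divr_gt0.
have mD2 := measurable_inv2D a0.
have i2 : P.-integrable setT (EFin \o fun w => (2 * (a ^+ 2 + (X w - x) ^+ 2))^-1).
  apply: (bounded_integrable P _ (fun w => normr_inv2D_le (X w - x) a0)).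
  exact: (measurableT_comp mD2).
have i3 : P.-integrable setT (EFin \o fun w => 2^-1 * osc a (2 * L) (X w - x)).
  exact: (integrableZl measurableT _ (iosc (2 * L))).
pose er w := xi a L (X w - x) ^+ 2 - (2 * (a ^+ 2 + (X w - x) ^+ 2))^-1 -
  2^-1 * osc a (2 * L) (X w - x).
have i12 : P.-integrable setT (EFin \o fun w =>
    xi a L (X w - x) ^+ 2 - (2 * (a ^+ 2 + (X w - x) ^+ 2))^-1).
  exact: (integrableB measurableT i1 i2).
have E : \int[P]_w (xi a L (X w - x) ^+ 2) - \int[P]_w (2 * (a ^+ 2 + (X w - x) ^+ 2))^-1 =
    \int[P]_w er w + 2^-1 * \int[P]_w osc a (2 * L) (X w - x).
  rewrite /er RintegralB//.
  by rewrite RintegralB// -RintegralZl// subrK.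
have erb : `|\int[P]_w er w| <= 5 / a ^+ 2 * expR (- (a * L)).
  apply: normr_Rintegral_le => [|w]; last first.
    by rewrite /er (mulrC 2^-1); apply: xi_sqr => //; exact: ltW.
  apply: measurable_funB; last first.
    by apply: measurable_funM => //; exact: (measurableT_comp (measurable_osc (2 * L) a0)).
  apply: measurable_funB; last exact: (measurableT_comp mD2).
  by apply: measurable_funX; exact: (measurableT_comp (measurable_xi L a0)).
have L21 : 1 <= 2 * L by lra.
have oscb := mean_osc_le L21.
have a3 : 0 <= 27 / a ^+ 3 by rewrite divr_ge0// exprn_ge0// ltW.
have c0 : 0 <= 1 + a^-1 + (a ^+ 2)^-1 by rewrite !addr_ge0// invr_ge0 ?sqr_ge0// ltW.
rewrite E; apply: le_trans (ler_normD _ _) _.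
rewrite [leLHS]addrC (mulrDl _ (5 / _)) (mulrDl _ (5 / _ * _)); apply: lerD.
  rewrite normrM ger0_norm// -[leRHS]mul1r; apply: ler_pM => //; first lra.
  apply: le_trans oscb _; apply: ler_wpM2l; first exact: mulr_ge0.
  by rewrite lef_pV2 ?posrE; lra.
apply: le_trans erb _; rewrite -[leRHS]mulrA; apply: ler_wpM2l; first by rewrite divr_ge0 ?sqr_ge0.
apply: le_trans (sqrM_expN_le L1); apply: ler_peMl; first exact: expR_ge0.
exact: exprn_ege1.
Qed.

End moments_xi.

(** * The sinc kernel estimator *)

Section sinc_estimator.
Context (R : realType).
Local Notation leb := (@lebesgue_measure R).
Implicit Types (a b h x mu : R).

Lemma Rintegral_sum_ord d (T : measurableType d) (nu : {measure set T -> \bar R})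
    (g : nat -> T -> R) n :
  (forall i, nu.-integrable setT (EFin \o g i)) ->
  nu.-integrable setT (EFin \o fun t => \sum_(i < n) g i t) /\
  \int[nu]_t (\sum_(i < n) g i t) = \sum_(i < n) \int[nu]_t g i t.
Proof.
move=> ig; elim: n => [|n [IH1 IH2]].
  split.
    rewrite (_ : EFin \o _ = cst 0%E); first exact: integrable0.
    by apply/funext => t /=; rewrite big_ord0.
  by under eq_Rintegral do rewrite big_ord0; rewrite Rintegral_cst// mul0r big_ord0.
have E : (fun t => \sum_(i < n.+1) g i t) = fun t => \sum_(i < n) g i t + g n t.
  by apply/funext => t; rewrite big_ord_recr.
split; first by rewrite E; exact: (integrableD measurableT IH1 (ig n)).
by rewrite E RintegralD// IH2 big_ord_recr.
Qed.

(** The real part of the integrand contributed by one observation, with [a = 1 / mu] and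
    [b = X_j - x]. *)
Let gsinc a h b t : R := \1_(`[-1, 1]) (h * t) * (expR (`|t| * a) * cos (t * b)).

(** The indicator restricts to [[- 1/h, 1/h]], and each half contributes [dcos1 a h^-1 b]; on the
    left half [|t| = - t], hence the use of [- a] there. *)
Lemma gsinc_integral a h b : 0 < a -> 0 < h ->
  leb.-integrable setT (EFin \o gsinc a h b) /\
  \int[leb]_t gsinc a h b t = 2 * dcos1 a h^-1 b.
Proof.
move=> a0 h0; set M := h^-1; have M0 : 0 < M by rewrite invr_gt0.
pose G t := expR (`|t| * a) * cos (t * b).
have cG : continuous G.
  move=> t; apply: cvgM.
    apply: (@continuous_comp _ _ _ (fun t : R => `|t| * a) expR); last exact: continuous_expR.
    by apply: cvgM; [exact: norm_continuous|exact: cvg_cst].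
  apply: (@continuous_comp _ _ _ (fun t : R => t * b) cos); last exact: continuous_cos.
  by apply: cvgM; [exact: cvg_id|exact: cvg_cst].
have iG (u v : R) : leb.-integrable `[u, v] (EFin \o G).
  apply: continuous_compact_integrable; first exact: segment_compact.
  exact: continuous_subspaceT.
have gE : gsinc a h b = G \_ `[-M, M].
  apply/funext => t; rewrite patchE /gsinc indicE !mem_setE !in_itv/=.
  have -> : (-1 <= h * t <= 1) = (- M <= t <= M).
    rewrite -(ler_pM2l h0 (- M)) -(ler_pM2l h0 t M) mulrN /M divff ?gt_eqF//.
  by case: ifP => _; rewrite ?mul1r ?mul0r.
split.
  rewrite gE -restrict_EFin; apply/integrable_restrict => //; rewrite setTI; exact: iG.
rewrite gE -Rintegral_mkcond.
have := @Rintegral_itvB R G (BLeft (- M)) (BRight M) 0 (iG _ _).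
rewrite !bnd_simp => /(_ _ _)/eqP; rewrite subr_eq => H.
have -> : \int[leb]_(t in `[-M, M]) G t =
    \int[leb]_(t in `]0, M]) G t + \int[leb]_(t in `[-M, 0]) G t.
  by apply/eqP/H; rewrite ?oppr_le0 ltW.
rewrite Rintegral_itv_obnd_cbnd; last first.
  by apply: integrableS (iG 0 M) => //; exact: subset_itv_oc_cc.
have E1 : \int[leb]_(t in `[0%R, M]) G t = dcos1 a M b.
  rewrite /Rintegral -[RHS]/(fine (dcos1 a M b)%:E) -dcos1E//; congr fine.
  apply: eq_integral => t; rewrite inE/= in_itv/= => /andP[t0 _].
  by rewrite /G ger0_norm// !(mulrC t).
have E2 : \int[leb]_(t in `[-M, 0%R]) G t = dcos1 a M b.
  have Na0 : - a != 0 by rewrite oppr_eq0 gt_eqF.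
  have NM0 : - M < 0 by rewrite oppr_lt0.
  have := integral_expcos b Na0 NM0 => /= E.
  have D0 := sum_sqr_gt0 b a0.
  transitivity (fine (\int[leb]_(r in `[(- M)%R, 0%R]) (expR (- a * r) * cos (b * r))%:E)%E).
    congr fine; apply: eq_integral => t; rewrite inE/= in_itv/= => /andP[_ t0].
    rewrite /G ler0_norm// (mulrC t b) (_ : - t * a = - a * t)//; ring.
  rewrite E/= mulrNN !mulrN !mulr0 expR0 cos0 sin0 cosN sinN sqrrN /dcos1.
  by field; rewrite gt_eqF.
by rewrite E1 E2; ring.
Qed.

(** Dividing by [phi_k] multiplies by [expR (|t| / mu)], and the phases combine to
    [expi (t * (X_j - x))], whose real part is the cosine of [gsinc]. The 2 of [gsinc_integral]
    turns [1 / (2 pi)] into [1 / pi]. *)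
Lemma decon_est_sincE (T : Type) (phi_k : R -> R[i]) mu (X : nat -> T -> R) (n : nat) h x (w : T) :
  0 < mu -> 0 < h -> (forall t, phi_k t = (expR (- `|t| / mu))%:C) ->
  decon_est (@phi_sinc R) phi_k X n h x w =
  n%:R^-1 * \sum_(j < n) pi^-1 * dcos1 mu^-1 h^-1 (X j w - x).
Proof.
move=> mu0 h0 phi_kE; rewrite /decon_est /decon_estC.
have a0 : 0 < mu^-1 by rewrite invr_gt0.
set F := fun t => _.
have FE t : complex.Re (F t) = n%:R^-1 * \sum_(j < n) gsinc mu^-1 h (X j w - x) t.
  pose c : R := n%:R^-1 * (\1_(`[-1, 1]) (h * t) * expR (`|t| * mu^-1)).
  have expiD (u v : R) : expi (u + v) = expi u * expi v.
    by rewrite /expi cosD sinD; simpc; congr (_ +i* _); rewrite addrC mulrC.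
  have -> : F t = c%:C * \sum_(j < n) expi (t * (X j w - x)).
    have -> : \sum_(j < n) expi (t * (X j w - x)) =
        expi (- (t * x)) * \sum_(j < n) expi (t * X j w).
      by rewrite mulr_sumr; apply: eq_bigr => j _; rewrite -expiD; congr expi; ring.
    rewrite /F /phi_emp phi_kE /phi_sinc mulNr expRN fmorphV/= invrK /c.
    rewrite !rmorphM/= fmorphV/= !rmorph_nat; ring.
  have ReD : {morph (@complex.Re R) : u v / u + v} by case=> ? ? [].
  have ReZ (z : R[i]) : complex.Re (c%:C * z) = c * complex.Re z.
    by case: z => u v /=; rewrite mul0r subr0.
  rewrite ReZ (big_morph _ ReD (erefl : complex.Re 0 = 0)) /c -mulrA; congr (_ * _).
  by rewrite mulr_sumr; apply: eq_bigr => j _; rewrite /gsinc mulrA.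
have ig j := (gsinc_integral (X j w - x) a0 h0).1.
have [isum sumE] := @Rintegral_sum_ord _ _ leb (fun j => gsinc mu^-1 h (X j w - x)) n ig.
have IE : \int[leb]_t complex.Re (F t) = n%:R^-1 * \sum_(j < n) (2 * dcos1 mu^-1 h^-1 (X j w - x)).
  under eq_Rintegral do rewrite FE.
  rewrite RintegralZl// sumE; congr (_ * _); apply: eq_bigr => j _.
  by rewrite (gsinc_integral _ a0 h0).2.
rewrite /cintegral IE /= mul0r subr0 mulrCA; congr (_ * _).
rewrite mulr_sumr; apply: eq_bigr => j _.
have : pi != 0 :> R by rewrite gt_eqF ?pi_gt0.
by move: (@pi R) => q q0; field.
Qed.

End sinc_estimator.

(** * From moment bounds to the limit theorem *)

Section positivity.
Context d (T : measurableType d) (R : realType) (P : probability T R).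

(** A nonnegative function with zero integral vanishes almost everywhere; if it is positive
    everywhere, the whole space would then be null. *)
Lemma Rintegral_probability_gt0 (f : T -> R) : P.-integrable setT (EFin \o f) ->
  (forall w, 0 < f w) -> 0 < \int[P]_w f w.
Proof.
move=> intf f0; rewrite lt_neqAle Rintegral_ge0 ?andbT; last by move=> w _; exact: ltW.
apply/negP => /eqP I0.
have mf : measurable_fun setT (EFin \o f) by exact: measurable_int intf.
have : ae_eq P setT (EFin \o f) (cst 0%E).
  apply/ae_eq_integral_abs => //.
  under eq_integral do rewrite gee0_abs ?lee_fin ?ltW//.
  rewrite -[LHS]fineK; last exact: (integrable_fin_num _ intf).
  by congr EFin; exact/esym.
move=> [N [mN N0 subN]].
have : P setT = 0%E.
  apply/eqP; rewrite -measure_le0 -N0 le_measure ?inE// => w _.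
  by apply: subN => /= /(_ Logic.I)/= [] /eqP; rewrite gt_eqF.
by move/eqP; rewrite [X in X == _]probability_setT onee_eq0.
Qed.

End positivity.

(** The moment bounds hold for [L = 1 / h n >= 1], which is eventually the case, and their rate
    [C / L] is [C * h n]. *)
Lemma cvg_dist_inv_bound (R : realType) (h u : nat -> R) (l C : R) :
  (forall n, 0 < h n) -> h n @[n --> \oo] --> (0 : R) ->
  (forall n, 1 <= (h n)^-1 -> `|u n - l| <= C / (h n)^-1) ->
  u n @[n --> \oo] --> l.
Proof.
move=> h0 h_to0 uC; apply/cvgrPdist_le => e e0.
have Ch : C * h n @[n --> \oo] --> C * (0 : R) by apply: cvgM => //; exact: cvg_cst.
rewrite mulr0 in Ch.
near=> n; rewrite distrC; apply: (le_trans (uC n _)).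
  rewrite -[leLHS]invr1 lef_pV2 ?posrE//.
  apply: le_trans (ler_norm _) _; rewrite -[leLHS]normrN -sub0r; near: n.
  by move/cvgrPdist_le : h_to0; exact.
rewrite invrK; apply: le_trans (ler_norm _) _; rewrite -[leLHS]normrN -sub0r; near: n.
by move/cvgrPdist_le : Ch; exact.
Unshelve. all: by end_near. Qed.

Theorem theorem2p2 (R : realType) (d : measure_display) (T : measurableType d)
  (P : probability T R) (mu : R) (mu_gt0 : 0 < mu)
  (k f : R -> R) (k_pdf : is_pdf k)
  (phi_kE : forall t : R, fourier k t = (expR (- `|t| / mu))%:C)
  (X Y Z : nat -> {RV P >-> R})
  (XE : forall (j : nat) (w : T), X j w = Y j w + Z j w)
  (X_iid : iid X)
  (YZ_indep : forall j : nat, independent2 (Y j) (Z j))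
  (Y_density : forall j : nat, has_density (Y j) f)
  (Z_density : forall j : nat, has_density (Z j) k)
  (h : nat -> R) (h_gt0 : forall n : nat, 0 < h n)
  (h_to0 : h n @[n --> \oo] --> (0 : R)) (x : R) :
  let g := convolution k f in
  let fnh n := decon_est (@phi_sinc R) (fourier k) X n (h n) x in
  let sigma2 := (2 * pi ^+ 2)^-1 *
    \int[lebesgue_measure]_u (mu ^+ 2 / (1 + mu ^+ 2 * (u - x) ^+ 2) * g u) in
  cvg_in_distribution P
    (fun n w => Num.sqrt n%:R * expR (- (mu * h n)^-1) *
                (fnh n w - fine ('E_P[fnh n])%E))
    (normal_prob 0 (Num.sqrt sigma2)).
Proof.
move=> g fnh sigma2.
pose a := mu^-1; have a0 : 0 < a by rewrite invr_gt0.
pose M n := (h n)^-1; have M0 n : 0 < M n by rewrite invr_gt0.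
pose xin n w := xi a (M n) (X 0%N w - x).
pose m n := \int[P]_w xin n w.
(* The centred summand of row [n], with the exponential factor already removed; it is bounded
   uniformly in [n]. *)
pose q n u := pi^-1 * (xi a (M n) (u - x) - m n).
have pi0 : 0 < pi^-1 :> R by rewrite invr_gt0 pi_gt0.
have mX j : measurable_fun setT (X j) := measurable_funPT (X j).
have mxi n : measurable_fun setT (fun u : R => xi a (M n) (u - x)).
  by apply: (measurableT_comp (measurable_xi (M n) a0)); exact: measurable_funB.
have mxiX n j : measurable_fun setT (fun w => xi a (M n) (X j w - x)).
  exact: (measurableT_comp (mxi n)).
have xib n u : `|xi a (M n) (u - x)| <= 3 / a by apply: normr_xi_le => //; exact: ltW.
have ixi n j := bounded_integrable P (mxiX n j) (fun w => xib n (X j w)).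
have mb n : `|m n| <= 3 / a.
  by apply: normr_Rintegral_le; [exact: (mxiX n 0%N)|move=> w; exact: xib].
have cosX t : 0 <= t -> `|\int[P]_w cos (t * (X 0%N w - x))| <= expR (- (a * t)).
  move=> t0; have := cos_mean_bound x (XE 0%N) (YZ_indep 0%N) (Z_density 0%N) (phi_kE t).
  by rewrite (ger0_norm (expR_ge0 _)) (ger0_norm t0) mulNr mulrC.
have mxij n j : \int[P]_w xi a (M n) (X j w - x) = m n.
  exact: (identically_distributed_Rintegral j 0 X_iid.2 (mxi n) (xib n)).
have fnhE n w : fnh n w = n%:R^-1 * \sum_(j < n) pi^-1 * (expR (a * M n) * xi a (M n) (X j w - x)).
  rewrite /fnh (decon_est_sincE X n x w mu_gt0 (h_gt0 n) phi_kE); congr (_ * _).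
  apply: eq_bigr => j _; congr (_ * _).
  by rewrite /xi mulrA expRxMexpNx_1 mul1r.
have Efnh n : (0 < n)%N -> fine ('E_P[fnh n])%E = pi^-1 * (expR (a * M n) * m n).
  move=> n0; transitivity (\int[P]_w fnh n w); first by rewrite unlock.
  pose t j w := pi^-1 * (expR (a * M n) * xi a (M n) (X j w - x)).
  have it j : P.-integrable setT (EFin \o t j).
    exact: (integrableZl measurableT _ (integrableZl measurableT _ (ixi n j))).
  have [isum sumE] := Rintegral_sum_ord n it.
  transitivity (\int[P]_w (n%:R^-1 * \sum_(j < n) t j w)).
    by apply: eq_Rintegral => w _; exact: fnhE.
  rewrite RintegralZl// sumE (eq_bigr (fun=> pi^-1 * (expR (a * M n) * m n))).
    by rewrite sumr_const card_ord -[X in _ * X]mulr_natl mulKf// pnatr_eq0 -lt0n.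
  move=> j _; rewrite /t RintegralZl//; last exact: (integrableZl measurableT _ (ixi n j)).
  by rewrite RintegralZl ?mxij//; exact: ixi.
(* The normalisation [expR (- (mu * h n)^-1)] is exactly the inverse of the factor [expR (a * M n)]
   in [fnh], which brings the statement to the form of [bounded_array_clt]. *)
have WE n w : Num.sqrt n%:R * expR (- (mu * h n)^-1) * (fnh n w - fine ('E_P[fnh n])%E) =
    (Num.sqrt n%:R)^-1 * \sum_(j < n) q n (X j w).
  (* For [n = 0] both sides vanish; [Efnh] covers positive [n]. *)
  have [->|n0] := eqVneq n 0%N; first by rewrite sqrtr0 !mul0r invr0 mul0r.
  rewrite Efnh ?lt0n// fnhE.
  have sn0 : Num.sqrt n%:R != 0 :> R by rewrite gt_eqF// sqrtr_gt0 ltr0n lt0n.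
  have sn2 : n%:R = Num.sqrt n%:R ^+ 2 :> R by rewrite sqr_sqrtr.
  pose S := \sum_(j < n) xi a (M n) (X j w - x).
  have -> : \sum_(j < n) q n (X j w) = pi^-1 * (S - Num.sqrt n%:R ^+ 2 * m n).
    by rewrite -mulr_sumr sumrB sumr_const card_ord -[X in _ - X]mulr_natl -sn2.
  have -> : \sum_(j < n) pi^-1 * (expR (a * M n) * xi a (M n) (X j w - x)) =
      pi^-1 * (expR (a * M n) * S).
    by rewrite /S !mulr_sumr.
  have -> : n%:R^-1 = (Num.sqrt n%:R ^+ 2)^-1 :> R by rewrite -sn2.
  rewrite invfM -/a -/(M n) expRN.
  have e0 : expR (a * M n) != 0 by rewrite gt_eqF// expR_gt0.
  move: (expR _) e0 (Num.sqrt _) sn0 S (pi^-1) => e e0 s s0 S p.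
  by field; rewrite e0 s0.
have iD : P.-integrable setT (EFin \o fun w => (2 * (a ^+ 2 + (X 0%N w - x) ^+ 2))^-1).
  apply: (bounded_integrable P _ (fun w => normr_inv2D_le (X 0%N w - x) a0)).
  by apply: (measurableT_comp (measurable_inv2D a0)); exact: measurable_funB.
(* As [g] is the density of [X 0], the integral in [sigma2] is an expectation, and its integrand is
   [1 / (a ^+ 2 + (u - x) ^+ 2)]. *)
have sigE : sigma2 = pi^-1 ^+ 2 * \int[P]_w (2 * (a ^+ 2 + (X 0%N w - x) ^+ 2))^-1.
  pose phi u := mu ^+ 2 / (1 + mu ^+ 2 * (u - x) ^+ 2).
  have phiE (u : R) : phi u = 2 * (2 * (a ^+ 2 + (u - x) ^+ 2))^-1.
    have d1 : 0 < 1 + mu ^+ 2 * (u - x) ^+ 2 by rewrite ltr_pwDl// mulr_ge0// sqr_ge0.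
    rewrite /phi /a invfM mulVKf// -[mu ^+ 2]invrK -invfM; congr _^-1.
    by field; rewrite gt_eqF.
  have phi_ge0 u : 0 <= phi u.
    by rewrite phiE mulr_ge0// invr_ge0 mulr_ge0// addr_ge0 ?sqr_ge0.
  have phi_le u : phi u <= 2 * (a ^+ 2)^-1.
    rewrite phiE ler_wpM2l//; apply: le_trans (normr_inv2D_le (u - x) a0).
    exact: ler_norm.
  have mphi : measurable_fun setT phi.
    rewrite (funext phiE); apply: measurable_funM => //.
    by apply: (measurableT_comp (measurable_inv2D a0)); exact: measurable_funB.
  have phib u : 0 <= phi u <= 2 * (a ^+ 2)^-1 by rewrite phi_ge0 phi_le.
  rewrite /sigma2 -(sum_density_integral (XE 0%N) (YZ_indep 0%N)
    (Y_density 0%N) (Z_density 0%N) mphi phib).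
  under [in LHS]eq_Rintegral do rewrite phiE.
  by rewrite RintegralZl// mulrA; congr (_ * _); rewrite invfM exprVn mulrAC mulVf// mul1r.
(* [bounded_array_clt] asks for a nondegenerate limit. *)
have sig0 : 0 < sigma2.
  rewrite sigE mulr_gt0 ?exprn_gt0//; apply: Rintegral_probability_gt0 => // w.
  by rewrite invr_gt0 mulr_gt0// sum_sqr_gt0.
have icst (c : R) : P.-integrable setT (EFin \o (fun=> c)).
  by apply: (@bounded_integrable _ _ _ _ (cst c) `|c|).
have ixim n : P.-integrable setT (EFin \o fun w => xi a (M n) (X 0%N w - x) - m n).
  apply: (@bounded_integrable _ _ _ _ _ (3 / a + 3 / a)); first exact: measurable_funB.
  by move=> w; apply: le_trans (ler_normB _ _) _; exact: lerD.
have s0 : 0 < Num.sqrt sigma2 by rewrite sqrtr_gt0.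
have WEf n := funext (WE n).
split=> [n|b _].
  rewrite WEf; apply: measurable_funM => //; apply: measurable_sum => j.
  by apply: measurable_funM => //; apply: measurable_funB.
rewrite [X in _ --> X](_ : _ = (ncdf (b / Num.sqrt sigma2))%:E); last exact: normal_prob_ncdf.
under eq_fun do rewrite WEf.
apply: (@bounded_array_clt _ _ _ _ X q (pi^-1 * (3 / a + 3 / a))) => //.
- move=> n; apply: measurable_funM => //; exact: measurable_funB.
- move=> n u; rewrite normrM (gtr0_norm pi0); apply: ler_wpM2l; first exact: ltW.
  by apply: le_trans (ler_normB _ _) _; exact: lerD.
- move=> n; transitivity (\int[P]_w (pi^-1 * (xi a (M n) (X 0%N w - x) - m n))); first by [].
  rewrite RintegralZl; [|exact: measurableT|exact: ixim].
  by rewrite RintegralB// Rintegral_probability_cst subrr mulr0.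
have ixi2 n : P.-integrable setT (EFin \o fun w => xi a (M n) (X 0%N w - x) ^+ 2).
  apply: (@bounded_integrable _ _ _ _ _ ((3 / a) ^+ 2)); first exact: measurable_funX.
  by move=> w; rewrite normrX lerXn2r ?nnegrE// divr_ge0// ltW.
have q2E n : \int[P]_w (q n (X 0%N w) ^+ 2) =
    pi^-1 ^+ 2 * (\int[P]_w (xi a (M n) (X 0%N w - x) ^+ 2) - m n * m n).
  transitivity (\int[P]_w (pi^-1 ^+ 2 * (xi a (M n) (X 0%N w - x) ^+ 2 -
      m n * (2 * xi a (M n) (X 0%N w - x) - m n)))).
    by apply: eq_Rintegral => w _; rewrite /q; ring.
  have i2xi : P.-integrable setT (EFin \o fun w => 2 * xi a (M n) (X 0%N w - x)).
    exact: (integrableZl measurableT _ (ixi n 0%N)).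
  have i2xim : P.-integrable setT (EFin \o fun w => 2 * xi a (M n) (X 0%N w - x) - m n).
    exact: (integrableB measurableT i2xi (icst (m n))).
  have im2xim : P.-integrable setT (EFin \o fun w => m n * (2 * xi a (M n) (X 0%N w - x) - m n)).
    exact: (integrableZl measurableT _ i2xim).
  rewrite RintegralZl//; last exact: (integrableB measurableT (ixi2 n) im2xim).
  rewrite RintegralB// RintegralZl// RintegralB// RintegralZl// Rintegral_probability_cst.
  by rewrite mxij; ring.
under eq_fun do rewrite q2E.
rewrite sqr_sqrtr; last exact: ltW.
rewrite sigE; apply: cvgM; first exact: cvg_cst.
(* The variance is a second moment minus [m n * m n]; the limit is written with [0 * 0] to match,
   since [m n] tends to 0. *)
rewrite -[X in _ --> X]subr0 -[X in _ --> _ - X](mulr0 0).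
have m_to0 : m n @[n --> \oo] --> (0 : R).
  apply: (cvg_dist_inv_bound h_gt0 h_to0) => n M1; rewrite subr0.
  exact: (mean_xi_le a0 cosX M1).
apply: cvgB; last exact: cvgM.
apply: (cvg_dist_inv_bound h_gt0 h_to0) => n M1.
exact: (mean_xi_sqr_le a0 cosX M1).
Qed.
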